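(* Let $H$ be the half-line discrete Schrödinger operator on $\ell^2(\mathbb{N})$ with bounded real potential $V$. Assume that there exist $2/3<\xi\le1$, $0<\alpha<1$ and a strictly increasing sequence $\{q_\ell\}_{\ell=1}^\infty$ of integers $>1$ such that the set $\mathfrak{E}_{q_\ell}$ is $(q_\ell^{-1/\alpha},\xi)$-clustered for all $\ell\in\mathbb{N}$. Then $\alpha_u^-\le\alpha$. If, moreover, the sequence $\{q_\ell\}_{\ell=1}^\infty$ is exponentially growing, then $\alpha_u^+\le\alpha$.
   Context: $\mathbb{N}=\{1,2,\dots\}$; $V=(V_n)_{n\in\mathbb{N}}$ is a bounded real sequence. The operator $H$ on $\ell^2(\mathbb{N})$ is $(H\psi)_n=\psi_{n+1}+\psi_{n-1}+V_n\psi_n$ for $n\ge2$ and $(H\psi)_1=\psi_2+V_1\psi_1$. For real $q\ge0$ and $T>0$, $$P(q,T)=\sum_{n>q}\frac2T\int_0^\infty\bigl|\langle\delta_n,e^{-itH}\delta_1\rangle\bigr|^2e^{-2t/T}\,dt .$$ The exponents are $$\alpha_u^+=\sup\Bigl\{\alpha>0:\limsup_{T\to\infty}\tfrac{\log P(T^\alpha,T)}{\log T}>-\infty\Bigr\},\qquad \alpha_u^-=\sup\Bigl\{\alpha>0:\liminf_{T\to\infty}\tfrac{\log P(T^\alpha,T)}{\log T}>-\infty\Bigr\}$$ (the supremum of the empty set is taken to be $0$). For an integer $q>1$, $\mathfrak{E}_q=\{\widetilde E_{q,j}\}_{j=1}^q$ is the set of the $q$ (simple, real) eigenvalues of $H^q(\pi/2)$,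 where $H^q(k)$ is the $q\times q$ Hermitian matrix with diagonal entries $V_1,\dots,V_q$, entries $1$ in positions $(n,n\pm1)$, entry $e^{-ik}$ in position $(1,q)$ and $e^{ik}$ in position $(q,1)$, and all other entries $0$ (for $q=2$ the entries falling in the same position are added). The set $\mathfrak{E}_q$ is $(\varepsilon,\xi)$-clustered if there is a finite collection $\{I_j\}_{j=1}^k$ ($k\le q$) of disjoint closed intervals, each of length at most $\varepsilon$, such that $\mathfrak{E}_q\subseteq\bigcup_{j=1}^kI_j$ and every $I_j$ contains at least $q^\xi$ points of $\mathfrak{E}_q$. A sequence $\{a_n\}$ of nonnegative numbers is exponentially growing if $\sup_n a_{n+1}/a_n<\infty$ and $\inf_n a_{n+1}/a_n>1$. *)

(* Defs.v *)
From HB Require Import structures.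
From mathcomp Require Import all_boot all_order all_algebra.
From mathcomp Require Import finmap complex.
From mathcomp Require Import all_classical all_reals all_analysis.

Set Implicit Arguments.
Unset Strict Implicit.
Unset Printing Implicit Defensive.

Import Order.TTheory GRing.Theory Num.Theory.
Import numFieldNormedType.Exports.

Local Open Scope classical_set_scope.
Local Open Scope ring_scope.
Local Open Scope complex_scope.

(** Sequences indexed by {1, 2, ...} are functions on [nat] whose value at 0
    is irrelevant: [V 0] is never used, and [schrodinger] returns 0 there. *)

Definition bounded_potential (R : realType) (V : nat -> R) : Prop :=
  exists M : R, forall n : nat, (1 <= n)%N -> `|V n| <= M.

Definition schrodinger (R : realType) (V : nat -> R) (psi : nat -> R[i]) :
    nat -> R[i] :=
  fun n => match n with
    | 0%N => 0
    | 1%N => psi 2 + (V 1)%:C * psi 1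
    | _ => psi n.+1 + psi n.-1 + (V n)%:C * psi n
    end.

Definition delta (R : realType) (m : nat) : nat -> R[i] :=
  fun n => (n == m)%:R.

(** The vector [e^A psi = \sum_k A^k psi / k!].  For a bounded operator on l^2
    the series converges in norm, hence entrywise, so each entry of the sum is
    the sum of the entries. *)
Definition exp_op (R : realType) (A : (nat -> R[i]) -> (nat -> R[i]))
    (psi : nat -> R[i]) : nat -> R[i] :=
  fun n => limn (series (fun k : nat => iter k A psi n / k`!%:R : R[i]^o)).

(** [evolution V t n = <delta_n, e^{-itH} delta_1>]: pairing with [delta_n]
    extracts the n-th entry. *)
Definition evolution (R : realType) (V : nat -> R) (t : R) : nat -> R[i] :=
  exp_op (fun psi n => - 'i * t%:C * schrodinger V psi n) (delta R 1).

(** [P(x, T)]; for [x >= 0] the index 0 does not contribute. *)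
Definition outside_prob (R : realType) (V : nat -> R) (x T : R) : \bar R :=
  (\sum_(0 <= n <oo | (x < n%:R)%R)
    ((2 / T)%:E * \int[lebesgue_measure]_(t in `[0%R, +oo[%classic)
       (Normc.normc (evolution V t n) ^+ 2 * expR (- (2 * t / T)))%:E))%E.

(** [log P(T^a, T) / log T], with [log 0 = -oo]. *)
Definition log_ratio (R : realType) (V : nat -> R) (a T : R) : \bar R :=
  (lne (outside_prob V (T `^ a) T) * ((ln T)^-1)%:E)%E.

(** The maximum with 0 encodes [sup set0 = 0], all members being positive. *)
Definition alpha_u_plus (R : realType) (V : nat -> R) : \bar R :=
  maxe 0%E (ereal_sup [set a%:E | a in
    [set a : R | 0 < a /\
      (-oo < limf_esup (log_ratio V a) (pinfty_nbhs R))%E]]).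

Definition alpha_u_minus (R : realType) (V : nat -> R) : \bar R :=
  maxe 0%E (ereal_sup [set a%:E | a in
    [set a : R | 0 < a /\
      (-oo < limf_einf (log_ratio V a) (pinfty_nbhs R))%E]]).

Definition expi (R : realType) (k : R) : R[i] := cos k +i* sin k.

(** Row and column [i : 'I_q] stand for position [i + 1].  The contributions
    are summed, so that for [q = 2] the corner entries add up with the
    off-diagonal ones. *)
Definition floquet_mx (R : realType) (V : nat -> R) (q : nat) (k : R) :
    'M[R[i]]_q :=
  \matrix_(i < q, j < q)
    ((V i.+1)%:C *+ (i == j)
     + ((i.+1 == j :> nat) || (j.+1 == i :> nat))%:R
     + expi (- k) *+ ((i.+1 == 1)%N && (j.+1 == q)%N)
     + expi k *+ ((i.+1 == q)%N && (j.+1 == 1)%N)).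

Definition floquet_spectrum (R : realType) (V : nat -> R) (q : nat) : set R :=
  [set E : R | eigenvalue (floquet_mx V q (pi / 2)) E%:C].

(** Intended for finite [S]: [fset_set] is empty on infinite sets. *)
Definition clustered (R : realType) (q : nat) (S : set R) (eps xi : R) : Prop :=
  exists (k : nat) (a b : 'I_k -> R),
    [/\ (k <= q)%N,
        trivIset setT (fun j => `[a j, b j]%classic),
        forall j, a j <= b j /\ b j - a j <= eps,
        S `<=` \bigcup_j `[a j, b j]%classic &
        forall j, q%:R `^ xi <= (#|` fset_set (S `&` `[a j, b j]%classic)|)%:R].

Definition exponentially_growing (R : realType) (a : nat -> R) : Prop :=
  (ereal_sup (range (fun n => (a n.+1 / a n)%:E)) < +oo)%E /\
  (1 < ereal_inf (range (fun n => (a n.+1 / a n)%:E)))%E.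

(* Main.v *)
(** The discriminant [D] of the q-periodic problem is monic with real zeros, the
    points of the spectrum at [k = pi / 2], and so are [D - 2] and [D + 2]; hence
    [|D| >= 2] somewhere between two zeros of [D].  Pick such a point [c_j] in each
    cluster.  Between neighbouring [c_j, c_k] replace, for the zeros [r] of the two
    clusters, [ln |E - r|] by a concave minorant of [ln |E - r + i eta|].  The sum
    over all zeros is then concave on [[c_j, c_k]], so its value at [E] is at least
    the smaller of the two end values, and these have gained [ln (eta / eps) - O(1)]
    for every zero of the cluster.  So [|D(E + i eta)| >= exp (q ^ xi)] for all real
    [E] as soon as [eta >= e^3 eps].

    A large discriminant makes the Green function small: if [u_n] is the n-th entry
    of [(H - z)^-1 delta_1] then [|u_q(z)| |D(z)| <= 1 + 2 / (Im z)^2], by Wronskian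
    and energy identities.  Finally, with [eta = 2 / T], conservation of flux through
    the bond [(q, q + 1)] turns [P(q, T)] into
    [- 2 \sum_k r_k Re u_q(lam_k + i eta)] where [r] is the spectral measure of
    the pair [(delta_(q+1), delta_1)], of total variation at most 1.  This is done for
    the truncations of [H] to [{1, ..., N}], which are finite matrices, and passes to
    the limit by Fatou's lemma.  As [T] is polynomially related to [q], the bound
    [(2 + T^2) exp (- q ^ xi)] beats every power of [T]. *)

Require Import Defs.
From HB Require Import structures.
From mathcomp Require Import all_boot all_order all_algebra.
From mathcomp Require Import finmap complex ring lra zify.
From mathcomp Require Import all_classical all_reals all_analysis measurable_realfun.

Import Order.TTheory GRing.Theory Num.Theory.
Import numFieldNormedType.Exports.

Set Implicit Arguments.
Unset Strict Implicit.
Unset Printing Implicit Defensive.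

Local Open Scope classical_set_scope.
Local Open Scope ring_scope.
Local Notation cRe := (@complex.Re _).
Local Notation cIm := (@complex.Im _).

(** * Three-term recurrences *)

(** The ring is arbitrary because the recurrence is run over the reals, over [R[i]], and over
    polynomials at ['X], where degrees are counted. It starts at [W 1], so the meaningless value of
    the potential at 0 never enters. *)
Fixpoint three_term (A : pzRingType) (x : A) (W : nat -> A) (a b : A) (n : nat) : A :=
  if n is m.+1 then
    if m is k.+1 then (x - W m) * three_term x W a b m - three_term x W a b k
    else b
  else a.

Lemma three_termSS (A : pzRingType) (x : A) (W : nat -> A) (a b : A) (n : nat) :
  three_term x W a b n.+2 =
  (x - W n.+1) * three_term x W a b n.+1 - three_term x W a b n.
Proof. by []. Qed.

Lemma three_term_unique (A : pzRingType) (x : A) (W u : nat -> A) (N : nat) :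
  (forall n, (n < N)%N -> u n.+2 = (x - W n.+1) * u n.+1 - u n) ->
  forall n, (n <= N.+1)%N -> u n = three_term x W (u 0) (u 1) n.
Proof.
move=> hu; elim/ltn_ind => [[|[|n]]] IH // hn.
by rewrite hu // three_termSS (IH n.+1 _ (ltnW hn)) // (IH n) //; lia.
Qed.

Lemma three_term_lin (A : comPzRingType) (x : A) (W : nat -> A) (a b : A) (n : nat) :
  three_term x W a b n = a * three_term x W 1 0 n + b * three_term x W 0 1 n.
Proof.
elim/ltn_ind: n => [[|[|n]]] IH.
  by rewrite /= mulr1 mulr0 addr0.
  by rewrite /= mulr1 mulr0 add0r.
by rewrite !three_termSS (IH n.+1) // (IH n) //; ring.
Qed.

Lemma three_term_wronskian (A : comPzRingType) (x : A) (W u v : nat -> A) (N : nat) :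
  (forall n, (n < N)%N -> u n.+2 = (x - W n.+1) * u n.+1 - u n) ->
  (forall n, (n < N)%N -> v n.+2 = (x - W n.+1) * v n.+1 - v n) ->
  forall n, (n <= N)%N ->
  u n.+1 * v n - u n * v n.+1 = u 1 * v 0 - u 0 * v 1.
Proof.
move=> hu hv; elim=> // n IH hn; rewrite -IH; last lia.
by rewrite hu // hv //; ring.
Qed.

(** * Flux and energy identities *)

Section Energy.
Variable R : rcfType.
Local Open Scope complex_scope.
Implicit Types (z w : R[i]) (u : nat -> R[i]) (V : nat -> R).

Definition sqnormc z : R := cRe z ^+ 2 + cIm z ^+ 2.

Lemma sqnormc_ge0 z : 0 <= sqnormc z.
Proof. by rewrite addr_ge0 ?sqr_ge0. Qed.

Lemma sqnormc_normc z : Normc.normc z ^+ 2 = sqnormc z.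
Proof. by case: z => a b; rewrite /= sqr_sqrtr // addr_ge0 ?sqr_ge0. Qed.

Lemma sqnormc_eq0 z : (sqnormc z == 0) = (z == 0).
Proof.
case: z => a b; rewrite /sqnormc /= paddr_eq0 ?sqr_ge0 // !sqrf_eq0.
by rewrite eq_complex.
Qed.

Lemma Im_normc_le z : `|cIm z| <= Normc.normc z.
Proof.
case: z => a b /=; rewrite -(@sqrtr_sqr _ b) ler_wsqrtr // lerDr sqr_ge0 //.
Qed.

Lemma Re_normc_le z : `|cRe z| <= Normc.normc z.
Proof.
case: z => a b /=; rewrite -(@sqrtr_sqr _ a) ler_wsqrtr // lerDl sqr_ge0 //.
Qed.

Lemma normc_ge0 z : 0 <= Normc.normc z.
Proof. by case: z => a b; exact: sqrtr_ge0. Qed.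

Lemma normc_conjc z : Normc.normc (conjc z) = Normc.normc z.
Proof. by case: z => a b /=; rewrite sqrrN. Qed.

Lemma Re_sum (I : Type) (s : seq I) (P : pred I) (F : I -> R[i]) :
  cRe (\sum_(i <- s | P i) F i) = \sum_(i <- s | P i) cRe (F i).
Proof. by apply: big_morph => [[a b] [c d]|]. Qed.

Definition flux u (n : nat) : R := cIm (conjc (u n) * u n.+1).

(** Multiplying the recurrence by [conjc (u n.+1)] and taking imaginary parts removes the real
    potential and leaves [flux u n.+1 - flux u n = cIm z * sqnormc (u n.+1)], which telescopes. *)
Lemma flux_sum V z u N :
  (forall n, (n < N)%N -> u n.+2 = (z - (V n.+1)%:C) * u n.+1 - u n) ->
  forall a b, (a <= b <= N)%N ->
  flux u b - flux u a = cIm z * \sum_(a <= n < b) sqnormc (u n.+1).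
Proof.
move=> hu a b /andP[hab hb]; rewrite mulr_sumr -telescope_sumr //.
apply: eq_big_nat => n /andP[_ hn]; rewrite /flux hu; last lia.
case: z (u n) (u n.+1) {hu} => [x y] [c d] [e f].
by rewrite /sqnormc /=; ring.
Qed.

Lemma flux_ge V z u N :
  0 <= cIm z ->
  (forall n, (n < N)%N -> u n.+2 = (z - (V n.+1)%:C) * u n.+1 - u n) ->
  forall a b n, (a <= n < b)%N -> (b <= N)%N ->
  cIm z * sqnormc (u n.+1) <= flux u b - flux u a.
Proof.
move=> hz hu a b n /andP[han hnb] hb.
rewrite (flux_sum hu) ?hb ?andbT; last lia.
rewrite ler_wpM2l // (big_cat_nat (n := n)) //=; last lia.
rewrite [X in _ + X]big_ltn // addrCA lerDl addr_ge0 //; apply: sumr_ge0 => i _;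
  exact: sqnormc_ge0.
Qed.

End Energy.

(** * Green function and discriminant *)

Section Discriminant.
Variable R : rcfType.
Variable V : nat -> R.
Local Open Scope complex_scope.
Implicit Types (z : R[i]) (n q N : nat).

Definition potC n : R[i] := (V n)%:C.
Definition phi z := three_term z potC 0 1.
Definition theta z := three_term z potC 1 0.
(** The trace of the transfer matrix from [(u 0, u 1)] to [(u q, u q.+1)], whose rows are
    [(theta q, phi q)] and [(theta q.+1, phi q.+1)]. *)
Definition discr q z : R[i] := phi z q.+1 + theta z q.

Lemma mul_le1 (a k : R) : 0 <= k -> a * k ^+ 2 <= k -> a * k <= 1.
Proof.
rewrite le_eqVlt => /orP[/eqP<- _|k0]; first by rewrite mulr0.
by rewrite expr2 mulrA -[X in _ <= X]mul1r ler_pM2r.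
Qed.

Lemma mul_le2 (a b k : R) : 0 <= k -> 0 <= b -> a * k ^+ 2 <= k * b -> a * k <= b.
Proof.
rewrite le_eqVlt => /orP[/eqP<- b0 _|k0 _]; first by rewrite mulr0.
by rewrite expr2 mulrA [X in _ <= X]mulrC ler_pM2r.
Qed.

Lemma normc_Im_conj_mul (s p : R[i]) : cIm (conjc s * p) <= Normc.normc s * Normc.normc p.
Proof.
by rewrite -(normc_conjc s) -Normc.normcM (le_trans (ler_norm _)) ?Im_normc_le.
Qed.

(** Multiply the Wronskian relation by the conjugate of [s * p], respectively [t * p'], and take
    imaginary parts. Up to sign, the left side is a sum of two nonnegative terms, one of which is at
    least [eta] times the squared modulus of that product; the right side is at most its modulus. *)
Lemma wronskian_green (eta : R) (s t p p' : R[i]) :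
  0 <= eta -> t * p - s * p' = 1 ->
  eta * sqnormc p <= cIm (conjc p * p') ->
  eta * sqnormc t <= - cIm (conjc s * t) ->
  eta * (Normc.normc s * Normc.normc p) <= 1 /\
  eta * (Normc.normc t * Normc.normc p') <= 1.
Proof.
move=> eta0 W hp ht; split; apply: mul_le1; rewrite ?mulr_ge0 ?normc_ge0 //;
  rewrite exprMn !sqnormc_normc.
- apply: le_trans (_ : - cIm (conjc (s * p) * (t * p - s * p')) <= _).
    have -> : - cIm (conjc (s * p) * (t * p - s * p')) =
        sqnormc p * (- cIm (conjc s * t)) + sqnormc s * cIm (conjc p * p').
      case: s t p p' {W hp ht} => [a b] [c d] [e f] [g h].
      by rewrite /sqnormc /=; ring.
    rewrite mulrCA; apply: le_trans (ler_wpM2l (sqnormc_ge0 s) hp) _.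
    rewrite lerDr mulr_ge0 ?sqnormc_ge0 //; apply: le_trans ht.
    by rewrite mulr_ge0 ?sqnormc_ge0.
  rewrite W mulr1 -Normc.normcM -(normc_conjc (s * p)).
  by apply: le_trans (ler_norm _) _; rewrite normrN Im_normc_le.
- apply: le_trans (_ : - cIm (conjc (t * p') * (t * p - s * p')) <= _).
    have -> : - cIm (conjc (t * p') * (t * p - s * p')) =
        sqnormc p' * (- cIm (conjc s * t)) + sqnormc t * cIm (conjc p * p').
      case: s t p p' {W hp ht} => [a b] [c d] [e f] [g h].
      by rewrite /sqnormc /=; ring.
    rewrite mulrA [_ * sqnormc p']mulrC.
    apply: le_trans (ler_wpM2l (sqnormc_ge0 p') ht) _.
    rewrite lerDl mulr_ge0 ?sqnormc_ge0 //; apply: le_trans hp.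
    by rewrite mulr_ge0 ?sqnormc_ge0.
  rewrite W mulr1 -Normc.normcM -(normc_conjc (t * p')).
  by apply: le_trans (ler_norm _) _; rewrite normrN Im_normc_le.
Qed.

Lemma flux_phi z q : 0 <= cIm z ->
  cIm z * sqnormc (phi z q) <= flux (phi z) q.
Proof.
move=> hz; have h0 : flux (phi z) 0 = 0 by rewrite /flux /=; ring.
case: q => [|q]; first by rewrite h0 /sqnormc /= expr0n addr0 mulr0.
have := @flux_ge _ V z (phi z) q.+1 hz (fun n _ => erefl) 0 q.+1 q.
by rewrite h0 subr0 leqnn /=; apply.
Qed.

Lemma phi_normc_le z q : 0 <= cIm z ->
  cIm z * Normc.normc (phi z q) <= Normc.normc (phi z q.+1).
Proof.
move=> hz; apply: mul_le2; rewrite ?normc_ge0 // sqnormc_normc.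
exact: le_trans (flux_phi q hz) (normc_Im_conj_mul _ _).
Qed.

Lemma theta_normc_le z q : (0 < q)%N -> 0 <= cIm z ->
  cIm z * Normc.normc (theta z q) <= Normc.normc (phi z q).
Proof.
case: q => [//|[|q]] _ hz; first by rewrite /= expr0n addr0 sqrtr0 mulr0 sqrtr_ge0.
apply: mul_le2; rewrite ?normc_ge0 // sqnormc_normc.
(* Here [q] is shifted by 2. The solution [v] vanishes at [q.+2], so it carries no flux at the right
   end. The flux through bond 0, where [v 0] is phi and [v 1] is minus theta at [q.+2], therefore
   pays for [cIm z * sqnormc (v 1)]. *)
pose v n := phi z q.+2 * theta z n - theta z q.+2 * phi z n.
have hv n : (n < q.+1)%N -> v n.+2 = (z - potC n.+1) * v n.+1 - v n.
  by move=> _; rewrite /v /phi /theta !(three_termSS _ _ _ _ n); ring.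
have := @flux_ge _ V z v q.+1 hz hv 0 q.+1 0 isT (leqnn _).
have -> : flux v q.+1 = 0.
  have -> : flux v q.+1 = cIm (conjc (v q.+1) * (v q.+2)) by [].
  have -> : v q.+2 = 0 by rewrite /v mulrC subrr.
  by rewrite mulr0.
have -> : v 1 = - theta z q.+2 by rewrite /v /= mulr0 mulr1 sub0r.
have v0 : v 0 = phi z q.+2 by rewrite /v /= mulr0 mulr1 subr0.
have -> : sqnormc (- theta z q.+2) = sqnormc (theta z q.+2).
  by case: (theta z q.+2) => a b; rewrite /sqnormc /=; ring.
move=> h; apply: (le_trans h).
have -> : 0 - flux v 0 = cIm (conjc (phi z q.+2) * theta z q.+2).
  rewrite /flux v0 (_ : v 1 = - theta z q.+2); last by rewrite /v /= mulr0 mulr1 sub0r.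
  by rewrite mulrN sub0r; case: (conjc _ * _) => a b /=; rewrite opprK.
by rewrite [X in _ <= X]mulrC; exact: normc_Im_conj_mul.
Qed.

(** The value [u 0 = -1] encodes the source at site 1, so [u] is a column of the resolvent of the
    truncation to 1, ..., N. The Wronskian trades [u q * phi q.+1] for [u q.+1 * phi q] minus 1.
    This product and [u q * theta q] are both at most [1 / cIm z ^+ 2] in modulus: passing from
    [phi q] to [phi q.+1], or from [theta q] to [phi q], costs one factor [1 / cIm z], and
    [wronskian_green] costs the other. *)
Lemma green_discr_le z (u : nat -> R[i]) N q :
  0 < cIm z -> (0 < q <= N)%N ->
  (forall n, (n < N)%N -> u n.+2 = (z - potC n.+1) * u n.+1 - u n) ->
  u 0 = -1 -> u N.+1 = 0 ->
  Normc.normc (u q) * Normc.normc (discr q z) <= 1 + 2 / cIm z ^+ 2.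
Proof.
move=> hz /andP[q0 qN] hu u0 uN; have hz' := ltW hz.
have W : u q.+1 * phi z q - u q * phi z q.+1 = 1.
  rewrite (three_term_wronskian hu (fun n _ => erefl)) // u0 /=; ring.
have fluxN : flux u N = 0 by rewrite /flux uN mulr0.
have ht : cIm z * sqnormc (u q.+1) <= - flux u q.
  have [qN'|] := ltnP q N.
    by have := flux_ge hz' hu (a := q) (b := N) (n := q); rewrite fluxN sub0r leqnn; apply.
  move=> Nq; have -> : q = N by lia.
  by rewrite fluxN uN /sqnormc /= expr0n addr0 mulr0 oppr0.
have [h1 h2] := wronskian_green hz' W (flux_phi q hz') ht.
have h3 := phi_normc_le q hz'; have h4 := theta_normc_le q0 hz'.
have h5 : Normc.normc (u q) * Normc.normc (phi z q.+1) <=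
    Normc.normc (u q.+1) * Normc.normc (phi z q) + 1.
  rewrite -!Normc.normcM.
  have -> : u q * phi z q.+1 = u q.+1 * phi z q + - 1 by rewrite -W; ring.
  by apply: (le_trans (le_normcD _ _)); rewrite normcN Normc.normc1.
have h6 : Normc.normc (discr q z) <= Normc.normc (phi z q.+1) + Normc.normc (theta z q).
  exact: le_normcD.
have := normc_ge0 (u q); have := normc_ge0 (u q.+1); have := normc_ge0 (phi z q).
have := normc_ge0 (phi z q.+1); have := normc_ge0 (theta z q).
move: h1 h2 h3 h4 h5 h6 hz; clear; set e := cIm z.
set x := Normc.normc (u q); set y := Normc.normc (u q.+1).
set a := Normc.normc (phi z q); set b := Normc.normc (phi z q.+1).
set c := Normc.normc (theta z q); set d := Normc.normc _.
move=> h1 h2 h3 h4 h5 h6 e0 c0 b0 a0 y0 x0.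
have k1 : e ^+ 2 * (x * c) <= 1.
  apply: le_trans h1; rewrite expr2 -mulrA ler_wpM2l ?(ltW e0) //.
  by rewrite mulrCA ler_wpM2l.
have k2 : e ^+ 2 * (y * a) <= 1.
  apply: le_trans h2; rewrite expr2 -mulrA ler_wpM2l ?(ltW e0) //.
  by rewrite mulrCA ler_wpM2l.
have k3 : x * d <= x * b + x * c by rewrite -mulrDr ler_wpM2l.
rewrite mulrC -ler_pdivlMr ?exprn_gt0 // in k1.
rewrite mulrC -ler_pdivlMr ?exprn_gt0 // in k2.
lra.
Qed.

End Discriminant.

(** * Real-rootedness and the Floquet spectrum *)

Lemma three_term_rmorph (A B : comNzRingType) (f : {rmorphism A -> B}) (x : A)
    (W : nat -> A) (a b : A) (n : nat) :
  f (three_term x W a b n) = three_term (f x) (f \o W) (f a) (f b) n.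
Proof.
elim/ltn_ind: n => [[|[|n]]] IH //.
by rewrite !three_termSS rmorphB rmorphM rmorphB (IH n.+1) // (IH n).
Qed.

Section RealRooted.
Variable R : rcfType.
Variable V : nat -> R.
Local Open Scope complex_scope.
Implicit Types (z rho : R[i]) (n q : nat).

Lemma size_three_term_dirichlet (A : nzRingType) (W : nat -> A) n :
  three_term 'X (fun k => (W k)%:P) 0 1 n.+1 \is monic /\
  size (three_term 'X (fun k => (W k)%:P) 0 1 n.+1) = n.+1.
Proof.
elim/ltn_ind: n => [[|[|n]]] IH; first by rewrite /= monic1 size_poly1.
  by rewrite /= mulr1 subr0 monicXsubC size_XsubC.
have [m1 s1] := IH n.+1 (leqnn _); have [m0 s0] := IH n (leqW (leqnn _)).
rewrite three_termSS; move: m1 s1 m0 s0; set p := three_term _ _ _ _ _.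
set r := three_term _ _ _ _ _ => m1 s1 m0 s0.
have sM : size (('X - (W n.+2)%:P) * p) = n.+3.
  by rewrite size_monicM ?monicXsubC ?monic_neq0 // size_XsubC s1.
have hlt : (size (- r) < size (('X - (W n.+2)%:P) * p)%R)%N.
  by rewrite size_polyN s0 sM.
split; last by rewrite size_polyDl.
by rewrite monicE lead_coefDl // -monicE monicMl ?monicXsubC.
Qed.

Lemma size_three_term_neumann (A : nzRingType) (W : nat -> A) n :
  (size (three_term 'X (fun k => (W k)%:P) 1 0 n.+1) <= n)%N.
Proof.
elim/ltn_ind: n => [[|[|n]]] IH; first by rewrite /= size_poly0.
  by rewrite /= mulr0 sub0r size_polyN size_poly1.
have s1 := IH n.+1 (leqnn _); have s0 := IH n (leqW (leqnn _)).
rewrite three_termSS; move: s1 s0; set p := three_term _ _ _ _ _.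
set r := three_term _ _ _ _ _ => s1 s0.
rewrite (leq_trans (size_polyD _ _)) // geq_max size_polyN (leq_trans s0) ?andbT; last lia.
by rewrite (leq_trans (size_polyMleq _ _)) // size_XsubC /=.
Qed.

Lemma wronskian_phi_theta z q :
  theta V z q * phi V z q.+1 - theta V z q.+1 * phi V z q = 1.
Proof.
transitivity (phi V z q.+1 * theta V z q - phi V z q * theta V z q.+1); first by ring.
rewrite (@three_term_wronskian _ z (potC V) (phi V z) (theta V z) q) // /phi /theta /=.
by ring.
Qed.

(** The transfer matrix has determinant 1 (the Wronskian) and trace [rho + rho'], so [rho] is an
    eigenvalue. An eigenvector is read off the first row; if that row gives zero, off the second; if
    both do, [(1, 0)] serves. *)
Lemma floquet_solution z rho rho' q :
  rho * rho' = 1 -> discr V q z = rho + rho' ->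
  exists a b : R[i], [/\ (a != 0) || (b != 0),
    three_term z (potC V) a b q = rho * a &
    three_term z (potC V) a b q.+1 = rho * b].
Proof.
move=> hrho hD.
have W := wronskian_phi_theta z q.
have hD' : phi V z q.+1 = rho + rho' - theta V z q by rewrite -hD /discr addrK.
have L a b n : three_term z (potC V) a b n = a * theta V z n + b * phi V z n.
  exact: three_term_lin.
have [/andP[/eqP p0 /eqP t1]|] :=
  boolP ((phi V z q == 0) && (rho - theta V z q == 0)); last first.
  rewrite negb_and => h; exists (phi V z q), (rho - theta V z q); split=> //.
    by rewrite L; ring.
  rewrite L; have -> : phi V z q * theta V z q.+1 =
      theta V z q * phi V z q.+1 - 1 by rewrite -W; ring.
  by rewrite -hrho hD'; ring.
have e1 : theta V z q = rho by move/eqP: t1; rewrite subr_eq0 => /eqP.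
have e2 : phi V z q.+1 = rho' by rewrite hD' e1; ring.
have [t0|t0] := eqVneq (theta V z q.+1) 0.
  exists 1, 0; rewrite oner_eq0 !L p0 t0 e1; split=> //; ring.
exists (phi V z q.+1 - rho), (- theta V z q.+1); split.
- by rewrite oppr_eq0 t0 orbT.
- by rewrite L p0 e1; ring.
- by rewrite L; ring.
Qed.

(** A solution with multiplier of modulus 1 has the same flux through bonds 0 and [q]. If [cIm z]
    were nonzero, the energy identity would make it vanish on 1, ..., q, and then also at 0. *)
Lemma discr_real z rho q :
  (0 < q)%N -> rho * conjc rho = 1 -> discr V q z = rho + conjc rho -> cIm z = 0.
Proof.
move=> q0 hrho hD; have [a [b [ab ha hb]]] := floquet_solution hrho hD.
apply/eqP; apply/negPn/negP => hz; set u := three_term z (potC V) a b in ha hb.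
have := @flux_sum _ V z u q (fun n _ => erefl) 0 q; rewrite leqnn /= => /(_ isT).
have -> : flux u q = flux u 0.
  rewrite /flux hb ha /= rmorphM.
  have -> : conjc rho * conjc a * (rho * b) = rho * conjc rho * (conjc a * b) by ring.
  by rewrite hrho mul1r.
rewrite subrr => /esym/eqP; rewrite mulf_eq0 (negbTE hz) /=.
rewrite psumr_eq0 => [/allP h|i _]; last exact: sqnormc_ge0.
have h' n : (n < q)%N -> u n.+1 = 0.
  move=> nq; apply/eqP; rewrite -sqnormc_eq0.
  by have := h n; rewrite mem_index_iota /= nq => /(_ isT).
have b0 : b = 0 by exact: (h' 0 q0).
have a0 : a = 0.
  have uq : u q = 0 by rewrite -(prednK q0); apply: h'; rewrite prednK.
  by rewrite -[a]mul1r -hrho mulrAC -ha uq mul0r.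
by rewrite a0 b0 eqxx in ab.
Qed.

(** The case [rho = 'i] concerns the discriminant itself, [rho = 1] and [rho = -1] the discriminant
    minus 2 and plus 2. As a polynomial, [phi q.+1] is monic of degree [q] and the remaining terms
    have smaller degree; the roots are real by [discr_real]. *)
Lemma discr_split rho q :
  (0 < q)%N -> rho * conjc rho = 1 ->
  exists rs : seq R, size rs = q /\
    forall z, discr V q z - (rho + conjc rho) = \prod_(r <- rs) (z - r%:C).
Proof.
move=> q0 hrho.
pose W k := (potC V k)%:P.
pose p := three_term 'X W 0 1 q.+1 + (three_term 'X W 1 0 q - (rho + conjc rho)%:P).
have evalE z a b n : (three_term 'X W a%:P b%:P n).[z] = three_term z (potC V) a b n.
  elim/ltn_ind: n => [[|[|n]]] IH; rewrite ?hornerC //.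
  by rewrite !three_termSS hornerD hornerN hornerM hornerXsubC (IH n.+1) // (IH n).
have pE z : p.[z] = discr V q z - (rho + conjc rho).
  rewrite /p !hornerD hornerN hornerC /discr /phi /theta.
  by rewrite -(evalE z 0 1) -(evalE z 1 0) polyC0 polyC1 addrA.
have [mphi sphi] := size_three_term_dirichlet (potC V) q.
have stheta : (size (three_term 'X W 1 0 q - (rho + conjc rho)%:P)%R < q.+1)%N.
  rewrite (leq_ltn_trans (size_polyD _ _)) // gtn_max size_polyN.
  rewrite (leq_ltn_trans (size_polyC_leq1 _)) // andbT.
  by case: (q) q0 => // n _; rewrite (leq_ltn_trans (size_three_term_neumann _ _)).
have mp : p \is monic.
  by rewrite /p monicE lead_coefDl ?sphi // -monicE.
have sp : size p = q.+1 by rewrite /p size_polyDl ?sphi.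
have [r hr] := closed_field_poly_normal p.
rewrite (monicP mp) scale1r in hr.
have rreal x : x \in r -> x = (cRe x)%:C.
  move=> xr; have : root p x by rewrite hr root_prod_XsubC.
  rewrite /root pE subr_eq0 => /eqP/(discr_real q0 hrho).
  by case: x {xr} => a b /= ->.
exists (map cRe r); split.
  by rewrite size_map; move: sp; rewrite hr size_prod_XsubC => -[].
move=> z; rewrite -pE hr horner_prod big_map.
by apply: eq_big_seq => x xr; rewrite hornerXsubC -rreal.
Qed.

Definition rdiscr q (x : R) : R := three_term x V 0 1 q.+1 + three_term x V 1 0 q.

Lemma rdiscrE q x : (rdiscr q x)%:C = discr V q x%:C.
Proof.
by rewrite /rdiscr /discr rmorphD /phi /theta !(three_term_rmorph (real_complex R)).
Qed.

Lemma rdiscr_split (rho : R[i]) q :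
  (0 < q)%N -> rho * conjc rho = 1 ->
  exists rs : seq R, size rs = q /\
    forall x, rdiscr q x - 2 * cRe rho = \prod_(r <- rs) (x - r).
Proof.
move=> q0 hrho; have [rs [srs h]] := discr_split q0 hrho.
exists rs; split=> // x; apply: (@complexI R).
transitivity (discr V q x%:C - (rho + conjc rho)).
  by rewrite -rdiscrE addcJ rmorphB rmorphM rmorph_nat.
by rewrite h rmorph_prod; apply: eq_bigr => r _; rewrite rmorphB.
Qed.

End RealRooted.

(** * The Floquet matrix at [pi / 2] and the zeros of the discriminant *)

Section FloquetSpectrum.
Variable R : realType.
Variable V : nat -> R.
Local Open Scope complex_scope.

Lemma sum_pick (A : pzRingType) (F : nat -> A) (q m : nat) :
  \sum_(i < q) F i * (nat_of_ord i == m)%:R = F m *+ (m < q)%N.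
Proof.
case: ltnP => mq.
  rewrite (bigD1 (Ordinal mq)) //= eqxx mulr1 big1 ?addr0 // => i.
  by rewrite -val_eqE /= => /negbTE ->; rewrite mulr0.
rewrite big1 // => i _; case: eqP => [im|]; last by rewrite mulr0.
by have := ltn_ord i; rewrite im ltnNge mq.
Qed.

(** [eigenvalue] refers to row vectors, so the phases in the boundary conditions are conjugate to
    those for column vectors. The corner entries supply the neighbours missing at the two ends. *)
Lemma floquet_mx_row (q : nat) (k : R) (u : nat -> R[i]) (j : 'I_q) :
  u 0 = expi k * u q -> u q.+1 = expi (- k) * u 1 ->
  ((\row_(i < q) u i.+1) *m floquet_mx V q k) 0 j =
  u j.+2 + u j + potC V j.+1 * u j.+1.
Proof.
move=> hu0 huq; rewrite mxE.
have q0 : (0 < q)%N by exact: leq_ltn_trans (ltn_ord j).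
pose T1 (i : 'I_q) := potC V i.+1 * u i.+1 * (nat_of_ord i == j)%:R.
pose T2 (i : 'I_q) := u i.+1 * (nat_of_ord i == j.-1)%:R *+ (0 < j)%N.
pose T3 (i : 'I_q) := u i.+1 * (nat_of_ord i == j.+1)%:R.
pose T4 (i : 'I_q) := (expi (- k) * u i.+1) * (nat_of_ord i == 0)%:R *+ (j.+1 == q)%N.
pose T5 (i : 'I_q) := (expi k * u i.+1) * (nat_of_ord i == q.-1)%:R *+ (nat_of_ord j == 0)%N.
rewrite (eq_bigr (fun i => T1 i + T2 i + T3 i + T4 i + T5 i)); last first.
  move=> i _; rewrite !mxE /T1 /T2 /T3 /T4 /T5.
  have -> : (i == j) = (nat_of_ord i == j) by [].
  have -> : (i.+1 == j :> nat) = (0 < j)%N && (nat_of_ord i == j.-1).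
    by case: (nat_of_ord j) => //= n; rewrite eqSS.
  have -> : (i.+1 == q :> nat) = (nat_of_ord i == q.-1) by lia.
  rewrite !eqSS [(j.+1 == i)%N]eq_sym.
  have excl : ~~ ((0 < j)%N && (nat_of_ord i == j.-1) && (nat_of_ord i == j.+1)) by lia.
  rewrite /potC; move: excl.
  case: (nat_of_ord i == j.-1); case: (nat_of_ord i == j.+1); case: (0 < j)%N => //= _;
  case: (nat_of_ord i == j); case: (nat_of_ord i == 0); case: (nat_of_ord j == 0);
  case: (j.+1 == q)%N; case: (nat_of_ord i == q.-1);
  rewrite /= ?mulr0n ?mulr1n ?mulr1 ?mulr0 ?addr0 ?add0r; ring.
rewrite !big_split /= /T1 /T2 /T3 /T4 /T5 !sumrMnl.
rewrite (sum_pick (fun n => potC V n.+1 * u n.+1)) !(sum_pick (fun n => u n.+1)).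
rewrite (sum_pick (fun n => expi (- k) * u n.+1)) (sum_pick (fun n => expi k * u n.+1)).
rewrite (ltn_ord j).
have -> : (j.-1 < q)%N by exact: leq_ltn_trans (leq_pred _) (ltn_ord j).
rewrite q0 (_ : (q.-1 < q)%N = true); last by lia.
rewrite -huq (prednK q0) -hu0 !mulr1n.
rewrite [in RHS](_ : u j.+2 = u j.+2 *+ (j.+1 < q)%N + u q.+1 *+ (j.+1 == q)%N); last first.
  have := ltn_ord j; rewrite leq_eqVlt => /orP[/eqP e|h].
    by rewrite [X in (X < q)%N]e [X in u X.+1 = _]e ltnn e eqxx mulr0n add0r.
  by rewrite h (ltn_eqF h) addr0.
rewrite [in RHS](_ : u j = u j.-1.+1 *+ (0 < j)%N + u 0 *+ (nat_of_ord j == 0)%N); last first.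
  by case: (nat_of_ord j) => [|n] /=; rewrite ?mulr0n ?add0r ?addr0.
ring.
Qed.

Lemma expi_pihalf : expi (pi / 2 : R) = 'i.
Proof. by rewrite /expi cos_pihalf sin_pihalf. Qed.

Lemma expi_Npihalf : expi (- (pi / 2) : R) = - 'i.
Proof.
rewrite /expi cosN sinN cos_pihalf sin_pihalf.
by apply/eqP; rewrite eq_complex /= oppr0 !eqxx.
Qed.

Lemma mulii : 'i * 'i = -1 :> R[i].
Proof. by rewrite -expr2 sqr_i. Qed.

(** Cayley-Hamilton: for the matrix M with rows [(T, P)] and [(T', F)], of determinant 1, the vector
    [(x, y)] has eigenvalue [- I]. Since [I * I = -1], the relation M^2 - (tr M) M + 1 = 0 applied
    to it leaves only [I] (tr M) times the vector. *)
Lemma antiperiodic_kernel (A : comPzRingType) (I F T T' P x y : A) :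
  I * I = -1 -> T * F - T' * P = 1 ->
  - I * y = x * T' + y * F -> - I * x = x * T + y * P ->
  I * (F + T) * x = 0 /\ I * (F + T) * y = 0.
Proof.
move=> II W e1 e2; split.
- have -> : I * (F + T) * x = (F + I) * (x * T + y * P + I * x)
    - P * (x * T' + y * F + I * y) - (I * I + (T * F - T' * P)) * x by ring.
  by rewrite II W -e1 -e2; ring.
- have -> : I * (F + T) * y = (T + I) * (x * T' + y * F + I * y)
    - T' * (x * T + y * P + I * x) - (I * I + (T * F - T' * P)) * y by ring.
  by rewrite II W -e1 -e2; ring.
Qed.

Lemma floquet_spectrumP (q : nat) (E : R) :
  (1 < q)%N -> floquet_spectrum V q E <-> rdiscr V q E = 0.
Proof.
move=> q1; have q0 : (0 < q)%N by exact: ltnW.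
rewrite /floquet_spectrum /=; split.
- move=> /eigenvalueP[v vM v0]; apply: (@complexI R); rewrite rdiscrE.
  pose o0 : 'I_q := Ordinal q0; have qq : (q.-1 < q)%N by lia.
  (* [v] is continued by the boundary values of [floquet_mx_row]: [insub m] is [None] for [m >= q],
     so [u q.+1] becomes [- 'i * u 1]. *)
  pose u n : R[i] := if n is m.+1 then (if insub m is Some i then v 0 i else - 'i * v 0 o0)
             else 'i * v 0 (Ordinal qq).
  have uE (i : 'I_q) : u i.+1 = v 0 i by rewrite /u valK.
  have uq : u q = v 0 (Ordinal qq) by rewrite -[in u q](prednK q0) (uE (Ordinal qq)).
  have uq1 : u q.+1 = - 'i * u 1 by rewrite (uE o0) /u insubN // ltnn.
  have vE : v = \row_(i < q) u i.+1 by apply/rowP => i; rewrite mxE uE.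
  have hu n : (n < q)%N -> u n.+2 = (E%:C - potC V n.+1) * u n.+1 - u n.
    move=> nq; have := congr1 (fun w : 'rV_q => w 0 (Ordinal nq)) vM.
    rewrite {1}vE floquet_mx_row ?expi_pihalf ?expi_Npihalf ?uq //.
    rewrite mxE -(uE (Ordinal nq)) /= => h.
    by rewrite mulrBl -h; ring.
  have hL n : (n <= q.+1)%N -> u n = u 0 * theta V E%:C n + u 1 * phi V E%:C n.
    by move=> nq; rewrite (three_term_unique hu) // three_term_lin.
  have e1 := hL q.+1 (leqnn _); have e2 := hL q (leqnSn _).
  have u0q : u 0 = 'i * u q by rewrite uq.
  have uq0 : u q = - 'i * u 0 by rewrite u0q mulrA mulNr mulii opprK mul1r.
  rewrite uq1 in e1; rewrite uq0 in e2.
  have [k0 k1] : 'i * discr V q E%:C * u 0 = 0 /\ 'i * discr V q E%:C * u 1 = 0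
    := antiperiodic_kernel mulii (wronskian_phi_theta V E%:C q) e1 e2.
  apply/eqP/negPn/negP => D0; move/negP: v0; apply; apply/eqP.
  have i0 : 'i != 0 :> R[i] by rewrite eq_complex /= oner_eq0 andbF.
  have {}D0 : discr V q E%:C != 0 := D0.
  have {}D0 : 'i * discr V q E%:C != 0 by rewrite mulf_neq0.
  have z0 : u 0 = 0 by move/eqP: k0; rewrite mulf_eq0 (negbTE D0) orFb => /eqP.
  have z1 : u 1 = 0 by move/eqP: k1; rewrite mulf_eq0 (negbTE D0) orFb => /eqP.
  apply/rowP => i; rewrite -(uE i) hL ?z0 ?z1 ?mul0r ?addr0 ?mxE //.
  by rewrite ltnW // ltnS ltn_ord.
- move=> D0.
  (* The multiplier is [- 'i], because [u 0 = 'i * u q] at [k = pi / 2]. *)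
  have hi : - 'i * 'i = 1 :> R[i] by rewrite mulNr mulii opprK.
  have hD : discr V q E%:C = - 'i + 'i by rewrite -rdiscrE D0 addNr.
  have [a [b [ab ha hb]]] := floquet_solution hi hD.
  pose u := three_term E%:C (potC V) a b.
  apply/eigenvalueP; exists (\row_(i < q) u i.+1).
    apply/rowP => j; rewrite floquet_mx_row.
    + by rewrite !mxE {1}/u three_termSS -/(u j.+1) -/(u j); ring.
    + by rewrite expi_pihalf /u ha mulrA mulrN mulii opprK mul1r.
    + by rewrite expi_Npihalf /u hb.
  apply/eqP => /rowP h.
  have b0 : b = 0 by have := h (Ordinal q0); rewrite !mxE.
  have qq : (q.-1 < q)%N by lia.
  have a0 : a = 0.
    have := h (Ordinal qq); rewrite !mxE /= prednK // /u ha => /eqP.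
    by rewrite mulf_eq0 oppr_eq0 eq_complex /= oner_eq0 andbF /= => /eqP.
  by rewrite a0 b0 eqxx in ab.
Qed.

End FloquetSpectrum.

(** * Products over clustered zeros *)

Section ClusterBound.
Variable R : realType.
Implicit Types (rs : seq R) (x y w r c E eta eps m : R).

Lemma ln_le_subr1 x : 0 < x -> ln x <= x - 1.
Proof. by move=> x0; have := @expR_ge1Dx R (ln x); rewrite lnK ?posrE //; lra. Qed.

Lemma continuous_prod_sub rs : continuous (fun x => \prod_(r <- rs) (x - r)).
Proof.
elim: rs => [|r rs IH] x.
  rewrite (_ : (fun x => _) = cst 1); first exact: cvg_cst.
  by apply/funext => y; rewrite big_nil.
rewrite (_ : (fun x => _) = (fun x => (x - r) * \prod_(r <- rs) (x - r))); last first.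
  by apply/funext => y; rewrite big_cons.
by apply: cvgM; [apply: cvgB; [exact: cvg_id|exact: cvg_cst]|exact: IH].
Qed.

(* Strict log-concavity of [|2 - g|] between consecutive zeros excludes a
   local maximum of [g] at a height in (0, 2). *)
Lemma real_rooted_max_ge2 (g : R -> R) rs x y w :
  continuous g -> (0 < size rs)%N ->
  (forall t, `|2 - g t| = \prod_(r <- rs) `|t - r|) ->
  x < w < y -> g x = 0 -> g y = 0 -> 0 < g w ->
  exists2 c, x <= c <= y & 2 <= g c.
Proof.
move=> gc rs0 gE /andP[xw wy] gx gy gw.
have xy : x <= y by lra.
have [c] := EVT_max xy (continuous_subspaceT gc).
rewrite in_itv /= => /andP[xc cy] cmax.
exists c; first by rewrite xc.
rewrite leNgt; apply/negP => c2.
have gwc : g w <= g c by apply: cmax; rewrite in_itv /= !ltW.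
have xc' : x < c by rewrite lt_neqAle xc andbT; apply/eqP => e; subst c; lra.
have cy' : c < y by rewrite lt_neqAle cy andbT; apply/eqP => e; subst c; lra.
pose h := Num.min (c - x) (y - c).
have h0 : 0 < h by rewrite lt_min; apply/andP; split; lra.
have h1 : h <= c - x by rewrite ge_min lexx.
have h2 : h <= y - c by rewrite ge_min lexx orbT.
have g1 : g (c - h) <= g c by apply: cmax; rewrite in_itv /=; apply/andP; split; lra.
have g2 : g (c + h) <= g c by apply: cmax; rewrite in_itv /=; apply/andP; split; lra.
have out r : r \in rs -> r < x \/ y < r.
  move=> rrs; have [|xr] := ltP r x; [by left|].
  have [|ry] := ltP y r; [by right|exfalso].
  have : `|2 - g r| = 0.
    by apply/eqP; rewrite gE prodf_seq_eq0; apply/hasP; exists r; rewrite //= subrr normr0.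
  have : g r <= g c by apply: cmax; rewrite in_itv /= xr.
  by move=> gr /eqP; rewrite normr_eq0 subr_eq0 => /eqP; lra.
(* The zeros lie outside [[x, y]], so for each of them [|(c - h - r) (c + h - r)| = (c - r)^2 - h^2
   < (c - r)^2]. Maximality at [c] gives the opposite inequality: at [c - h] and [c + h] the
   function [2 - g] is at least [2 - g c > 0]. *)
have lt : `|2 - g (c - h)| * `|2 - g (c + h)| < `|2 - g c| * `|2 - g c|.
  rewrite !gE -!big_split /= !big_seq; apply: ltr_prod.
    by case: (rs) rs0 => //= r s _; rewrite mem_head.
  move=> r rrs; rewrite -!normrM normr_ge0 /=.
  have -> : `|(c - r) * (c - r)| = (c - r) ^+ 2.
    by rewrite -expr2 ger0_norm // sqr_ge0.
  have -> : (c - h - r) * (c + h - r) = (c - r) ^+ 2 - h ^+ 2 by ring.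
  have hh : h ^+ 2 <= (c - r) ^+ 2.
    by case: (out _ rrs) => ?; nra.
  rewrite ger0_norm ?subr_ge0 // ltrBlDr ltrDl exprn_gt0 //.
rewrite !ger0_norm in lt; [nra|lra|lra|lra].
Qed.

Lemma exists_between_notin rs x y : x < y -> exists2 w, x < w < y & w \notin rs.
Proof.
move=> xy; pose f n : R := x + (y - x) / n.+2%:R.
pose ws := map f (iota 0 (size rs).+1).
have finj : injective f.
  have d : y - x != 0 by rewrite subr_eq0 gt_eqF.
  by rewrite /f => i j /addrI/(mulfI d)/invr_inj/eqP; rewrite eqr_nat !eqSS => /eqP.
have : has (fun w => w \notin rs) ws.
  rewrite -[has _ _]negbK -all_predC; apply/negP => /allP h.
  have : (size ws <= size rs)%N.
    apply: uniq_leq_size => [|w /h]; last by rewrite /= negbK.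
    by rewrite map_inj_uniq ?iota_uniq.
  by rewrite size_map size_iota ltnn.
move=> /hasP[_ /mapP[n _ ->] nrs]; exists (f n) => //.
have n2 : 0 < n.+2%:R^-1 :> R by rewrite invr_gt0.
have n3 : n.+2%:R^-1 < 1 :> R by rewrite invf_lt1 // ltr1n.
have d : 0 < y - x by rewrite subr_gt0.
rewrite /f; move: n2 n3; move: (n.+2%:R^-1) => i n2 n3.
have k1 := mulr_gt0 d n2.
have k2 : 0 < (y - x) * (1 - i) by rewrite mulr_gt0 ?subr_gt0.
by rewrite mulrBr mulr1 in k2; apply/andP; split; lra.
Qed.

Variables (eta : R) (eta0 : 0 < eta).

Definition lnmod x : R := ln (Num.sqrt (x ^+ 2 + eta ^+ 2)).

(* The largest concave minorant of [lnmod] that agrees with [ln] from [eta]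
   on: the tangent to [ln] at [eta], followed by [ln]. *)
Definition ln_tangent x : R := if x <= eta then ln eta - 1 + x / eta else ln x.

Lemma ln_le_lnmod x y : 0 < y -> y <= `|x| -> ln y <= lnmod x.
Proof.
move=> y0 yx; rewrite /lnmod ler_ln ?posrE //.
  by rewrite (le_trans yx) // -sqrtr_sqr ler_wsqrtr // lerDl sqr_ge0.
by rewrite sqrtr_gt0 ltr_wpDl ?sqr_ge0 ?exprn_gt0.
Qed.

Lemma ln_eta_le_lnmod x : ln eta <= lnmod x.
Proof.
rewrite /lnmod ler_ln ?posrE //.
  by rewrite -{1}(gtr0_norm eta0) -sqrtr_sqr ler_wsqrtr // lerDr sqr_ge0.
by rewrite sqrtr_gt0 ltr_wpDl ?sqr_ge0 ?exprn_gt0.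
Qed.

Lemma ln_tangent_le_lnmod x : ln_tangent x <= lnmod x.
Proof.
rewrite /ln_tangent; case: (leP x eta) => hx; last first.
  by apply: ln_le_lnmod; [exact: lt_trans hx|exact: ler_norm].
apply: le_trans (ln_eta_le_lnmod x).
have : x / eta <= 1 by rewrite ler_pdivrMr // mul1r.
lra.
Qed.

Lemma ln_le_ln_tangent x : 0 < x -> ln x <= ln_tangent x.
Proof.
move=> x0; rewrite /ln_tangent; case: (leP x eta) => // _.
have := @ln_le_subr1 (x / eta) (divr_gt0 x0 eta0).
by rewrite ln_div ?posrE //; lra.
Qed.

(** The range starts at [- eta] because [c - r] can be as low as [- eps] within a cluster. The loss
    of 2, together with the 1 to be gained per zero, is the 3 in [ln eps + 3 <= ln eta]. *)
Lemma ln_tangent_ge x : - eta <= x -> ln eta - 2 <= ln_tangent x.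
Proof.
move=> hx; rewrite /ln_tangent; case: (leP x eta) => hx'.
  have : -1 <= x / eta by rewrite ler_pdivlMr // mulN1r.
  lra.
have : ln eta <= ln x by rewrite ler_ln ?posrE ?(ltW hx') // (lt_trans eta0 hx').
lra.
Qed.

(** Concavity in tangent-line form, [(Num.max x eta)^-1] being the slope at [x]. Each case reduces
    to [ln t <= t - 1]; when [y <= eta < x] the sign of [(1 - y / eta) * (eta / x - 1)] is used as
    well. *)
Lemma ln_tangent_supergradient x y :
  ln_tangent y <= ln_tangent x + (y - x) / Num.max x eta.
Proof.
rewrite /ln_tangent; case: (leP x eta) => hx.
  case: (leP y eta) => hy; first by rewrite le_eqVlt; apply/orP; left; apply/eqP; ring.
  have y0 : 0 < y by exact: lt_trans hy.
  have := @ln_le_ln_tangent y y0.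
  have := @ln_le_subr1 (y / eta) (divr_gt0 y0 eta0).
  by rewrite ln_div ?posrE // mulrBl; lra.
have x0 : 0 < x by exact: lt_trans hx.
have xx : x / x = 1 by rewrite divff // gt_eqF.
case: (leP y eta) => hy; last first.
  have y0 : 0 < y by exact: lt_trans hy.
  have := @ln_le_subr1 (y / x) (divr_gt0 y0 x0).
  by rewrite ln_div ?posrE // mulrBl xx; lra.
have := @ln_le_subr1 (eta / x) (divr_gt0 eta0 x0).
rewrite ln_div ?posrE // mulrBl xx.
have : (1 - y / eta) * (eta / x - 1) <= 0.
  rewrite mulr_ge0_le0 // ?subr_ge0 ?subr_le0 ler_pdivrMr // mul1r //.
  exact: ltW.
have -> : (1 - y / eta) * (eta / x - 1) = eta / x - 1 - y / x + y / eta.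
  by field; rewrite !gt_eqF.
lra.
Qed.

(** The hypothesis puts [x] and [y] on the same side of the singularity at 0, where the logarithm of
    the modulus is concave. *)
Lemma ln_supergradient x y : 0 < y / x -> ln `|y| <= ln `|x| + (y - x) / x.
Proof.
move=> yx; have x0 : x != 0 by apply: contraTneq yx => ->; rewrite invr0 mulr0 ltxx.
have y0 : y != 0 by apply: contraTneq yx => ->; rewrite mul0r ltxx.
have := ln_le_subr1 yx; rewrite mulrBl divff // -{1}(gtr0_norm yx) normf_div.
by rewrite ln_div ?posrE ?normr_gt0 //; lra.
Qed.

Lemma sumr_count rs (P : pred R) : \sum_(r <- rs) (P r)%:R = (count P rs)%:R :> R.
Proof. by elim: rs => [|r rs IH]; rewrite ?big_nil // big_cons IH /= natrD. Qed.

Section OneCluster.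
Variables (eps : R) (eps_eta : ln eps + 3 <= ln eta).
Variables (rs : seq R) (m : R).

Let inI a b r := (a <= r <= b).

Lemma cluster_sum_ge a b c :
  (m <= (count (inI a b) rs)%:R) -> 0 <= \sum_(r <- rs) ln `|c - r| ->
  m <= \sum_(r <- rs) (ln `|c - r| + (inI a b r)%:R).
Proof. by move=> hm hc; rewrite big_split /= sumr_count; lra. Qed.

Lemma ln_dist_le a b c r :
  b - a <= eps -> a <= c <= b -> c != r -> inI a b r -> ln `|c - r| <= ln eps.
Proof.
move=> hab /andP[ac cb] cr /andP[ar rb].
have cr0 : 0 < `|c - r| by rewrite normr_gt0 subr_eq0.
have cre : `|c - r| <= eps by rewrite ler_norml; apply/andP; split; lra.
by rewrite ler_ln ?posrE // (lt_le_trans cr0).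
Qed.

(** This serves when [E] lies beyond all the chosen points. Moving from the outermost point [c] to
    [E] brings no zero of another cluster closer, while each zero of the cluster of [c] rises from
    at most [ln eps] to at least [ln eta]. *)
Lemma one_cluster_bound a b c E :
  b - a <= eps -> a <= c <= b ->
  (forall r, r \in rs -> c != r) -> 0 <= \sum_(r <- rs) ln `|c - r| ->
  m <= (count (inI a b) rs)%:R ->
  (forall r, r \in rs -> ~~ inI a b r -> `|c - r| <= `|E - r|) ->
  m <= \sum_(r <- rs) lnmod (E - r).
Proof.
move=> hab hc cr hsum hm hE; apply: le_trans (cluster_sum_ge hm hsum) _.
rewrite !big_seq; apply: ler_sum => r rrs.
have [rI|rI] := boolP (inI a b r).
  have := ln_dist_le hab hc (cr _ rrs) rI.
  have := ln_eta_le_lnmod (E - r); rewrite mulr1n; have := eps_eta; lra.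
rewrite /= addr0; apply: ln_le_lnmod; last exact: hE.
by rewrite normr_gt0 subr_eq0 cr.
Qed.

Lemma two_cluster_bound a1 b1 c1 a2 b2 c2 E :
  b1 - a1 <= eps -> a1 <= c1 <= b1 -> b2 - a2 <= eps -> a2 <= c2 <= b2 -> b1 < a2 ->
  eps <= eta ->
  (forall r, r \in rs -> c1 != r) -> (forall r, r \in rs -> c2 != r) ->
  0 <= \sum_(r <- rs) ln `|c1 - r| -> 0 <= \sum_(r <- rs) ln `|c2 - r| ->
  m <= (count (inI a1 b1) rs)%:R -> m <= (count (inI a2 b2) rs)%:R ->
  c1 <= E <= c2 ->
  (forall r, r \in rs -> ~~ inI a1 b1 r -> ~~ inI a2 b2 r -> r < c1 \/ c2 < r) ->
  m <= \sum_(r <- rs) lnmod (E - r).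
Proof.
move=> h1 hc1 h2 hc2 h12 hee cr1 cr2 s1 s2 m1 m2 /andP[E1 E2] out.
(* [G r] is the value at [E] of the concave function attached to the zero [r], and [s r] its slope
   there. The tangent replaces the logarithm towards the zeros of the two clusters, hence the
   argument [E - r] for the left one and [r - E] for the right one. All other zeros lie outside
   [[c1, c2]], where the logarithm itself is concave. *)
pose s r := if inI a1 b1 r then (Num.max (E - r) eta)^-1
  else if inI a2 b2 r then - (Num.max (r - E) eta)^-1 else (E - r)^-1.
pose G r := if inI a1 b1 r then ln_tangent (E - r)
  else if inI a2 b2 r then ln_tangent (r - E) else ln `|E - r|.
have disj r : inI a1 b1 r -> inI a2 b2 r = false.
  by move=> /andP[? ?]; apply/negP => /andP[? ?]; lra.
have GL r : r \in rs -> G r <= lnmod (E - r).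
  move=> rrs; rewrite /G; case: ifPn => r1; first exact: ln_tangent_le_lnmod.
  case: ifPn => r2.
    by rewrite (_ : lnmod (E - r) = lnmod (r - E)) ?ln_tangent_le_lnmod // /lnmod -sqrrN opprB.
  apply: ln_le_lnmod => //; rewrite normr_gt0 subr_eq0; apply/eqP => Er.
  by case: (out r rrs r1 r2); lra.
have at1 r : r \in rs -> ln `|c1 - r| + (inI a1 b1 r)%:R <= G r + s r * (c1 - E).
  move=> rrs; rewrite /G /s; case: ifPn => r1.
    rewrite [_^-1 * _]mulrC; have := ln_tangent_supergradient (E - r) (c1 - r).
    have -> : c1 - r - (E - r) = c1 - E by ring.
    have := ln_dist_le h1 hc1 (cr1 _ rrs) r1.
    have := @ln_tangent_ge (c1 - r); move: r1 hc1 => /andP[? ?] /andP[? ?].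
    have hh : - eta <= c1 - r by lra.
    by move=> /(_ hh); rewrite mulr1n; have := eps_eta; lra.
  rewrite addr0; case: ifPn => r2.
    have := ln_tangent_supergradient (r - E) (r - c1).
    have -> : r - c1 - (r - E) = - (c1 - E) by ring.
    have rc : 0 < r - c1 by move: r2 hc1 => /andP[? ?] /andP[? ?]; lra.
    have := ln_le_ln_tangent rc; rewrite (distrC c1 r) (gtr0_norm rc).
    by rewrite mulNr mulrC mulNr; lra.
  have := @ln_supergradient (E - r) (c1 - r).
  have -> : c1 - r - (E - r) = c1 - E by ring.
  rewrite [_^-1 * _]mulrC; apply.
  by case: (out r rrs r1 r2) => ?; [rewrite divr_gt0 //; lra|
    rewrite -mulrNN -invrN divr_gt0 //; lra].
have at2 r : r \in rs -> ln `|c2 - r| + (inI a2 b2 r)%:R <= G r + s r * (c2 - E).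
  move=> rrs; rewrite /G /s; case: ifPn => r1.
    rewrite (disj r r1) addr0 [_^-1 * _]mulrC.
    have := ln_tangent_supergradient (E - r) (c2 - r).
    have -> : c2 - r - (E - r) = c2 - E by ring.
    have rc : 0 < c2 - r by move: r1 hc2 => /andP[? ?] /andP[? ?]; lra.
    by have := ln_le_ln_tangent rc; rewrite (gtr0_norm rc); lra.
  case: ifPn => r2.
    have := ln_tangent_supergradient (r - E) (r - c2).
    have -> : r - c2 - (r - E) = - (c2 - E) by ring.
    have := ln_dist_le h2 hc2 (cr2 _ rrs) r2.
    have := @ln_tangent_ge (r - c2); move: r2 hc2 => /andP[? ?] /andP[? ?].
    have hh : - eta <= r - c2 by lra.
    by move=> /(_ hh); rewrite mulr1n !mulNr [_^-1 * _]mulrC; have := eps_eta; lra.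
  have := @ln_supergradient (E - r) (c2 - r).
  have -> : c2 - r - (E - r) = c2 - E by ring.
  rewrite addr0 [_^-1 * _]mulrC; apply.
  by case: (out r rrs r1 r2) => ?; [rewrite divr_gt0 //; lra|
    rewrite -mulrNN -invrN divr_gt0 //; lra].
apply: le_trans (_ : \sum_(r <- rs) G r <= _); last first.
  by rewrite !big_seq; apply: ler_sum => r; exact: GL.
have k1 : m <= \sum_(r <- rs) G r + (\sum_(r <- rs) s r) * (c1 - E).
  apply: le_trans (cluster_sum_ge m1 s1) _; rewrite mulr_suml -big_split /= !big_seq.
  by apply: ler_sum => r; exact: at1.
have k2 : m <= \sum_(r <- rs) G r + (\sum_(r <- rs) s r) * (c2 - E).
  apply: le_trans (cluster_sum_ge m2 s2) _; rewrite mulr_suml -big_split /= !big_seq.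
  by apply: ler_sum => r; exact: at2.
(* The tangent line of the sum at [E] is at least [m] both at [c1] and at [c2]. Whatever the sign of
   its slope, at one of these two points it is at most the value at [E]. *)
have [S0|S0] := leP 0 (\sum_(r <- rs) s r).
  by apply: le_trans k1 _; rewrite gerDl mulr_ge0_le0 // subr_le0.
by apply: le_trans k2 _; rewrite gerDl mulr_le0_ge0 // ?subr_ge0 // ltW.
Qed.

End OneCluster.
End ClusterBound.

(** * Lower bound on the discriminant off the real axis *)

Section ClusteredDiscriminant.
Variable R : realType.
Variable V : nat -> R.
Local Open Scope complex_scope.
Implicit Types (rs : seq R).

Lemma ln_prod (I : eqType) (s : seq I) (F : I -> R) :
  (forall i, i \in s -> 0 < F i) ->
  ln (\prod_(i <- s) F i) = \sum_(i <- s) ln (F i).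
Proof.
elim: s => [|i s IH] h; first by rewrite !big_nil ln1.
have hs j : j \in s -> 0 < F j by move=> js; apply: h; rewrite inE js orbT.
rewrite !big_cons lnM ?posrE ?IH //; first by apply: h; rewrite mem_head.
by rewrite big_seq prodr_gt0.
Qed.

Lemma normc_prod (I : Type) (s : seq I) (F : I -> R[i]) :
  Normc.normc (\prod_(i <- s) F i) = \prod_(i <- s) Normc.normc (F i).
Proof. by apply: big_morph; [exact: Normc.normcM|exact: Normc.normc1]. Qed.

(** At some [w] between the zeros the discriminant is nonzero. According to its sign there,
    [real_rooted_max_ge2] is applied to it with the zeros of [discr - 2], or to its negative with
    the zeros of [discr + 2]. *)
Lemma rdiscr_hump q x y : (0 < q)%N -> x < y ->
  rdiscr V q x = 0 -> rdiscr V q y = 0 ->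
  exists2 c, x <= c <= y & 2 <= `|rdiscr V q c|.
Proof.
move=> q0 xy hx hy.
have split1 (rho : R) : rho * rho = 1 -> exists rs : seq R, size rs = q /\
    forall t, rdiscr V q t - 2 * rho = \prod_(r <- rs) (t - r).
  move=> hrho; apply: (@rdiscr_split _ V rho%:C) => //.
  by rewrite conjc_real -rmorphM hrho.
have [rs [_ hrs]] : exists rs : seq R, size rs = q /\
    forall t, rdiscr V q t - 2 * 0 = \prod_(r <- rs) (t - r).
  apply: (@rdiscr_split _ V 'i) => //.
  by apply/eqP; rewrite eq_complex /=; apply/andP; split; apply/eqP; ring.
have [rs1 [s1 h1]] := split1 1 (mulr1 1).
have [rs2 [s2 h2]] := split1 (-1) (etrans (mulrNN 1 1) (mulr1 1)).
have cD : continuous (rdiscr V q).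
  rewrite (_ : rdiscr V q = fun t => \prod_(r <- rs) (t - r)).
    exact: continuous_prod_sub.
  by apply/funext => t; rewrite -hrs mulr0 subr0.
have [w hw wrs] := exists_between_notin rs xy.
have : rdiscr V q w != 0.
  have -> : rdiscr V q w = \prod_(r <- rs) (w - r) by rewrite -hrs mulr0 subr0.
  rewrite prodf_seq_neq0; apply/allP => r rrs /=.
  by rewrite subr_eq0; apply: contraNneq wrs => ->.
rewrite neq_lt => /orP[wneg|wpos].
- have [|||||||c hc1 hc2] := @real_rooted_max_ge2 R (fun t => - rdiscr V q t) rs2 x y w.
  + by move=> t; apply: cvgN; exact: cD.
  + by rewrite s2.
  + move=> t; rewrite opprK -normr_prod -h2; congr (`|_|); ring.
  + exact: hw.
  + by rewrite hx oppr0.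
  + by rewrite hy oppr0.
  + by rewrite oppr_gt0.
  by exists c => //; rewrite -normrN (le_trans hc2) // ler_norm.
- have [|||||||c hc1 hc2] := @real_rooted_max_ge2 R (rdiscr V q) rs1 x y w => //.
  + by rewrite s1.
  + by move=> t; rewrite -normr_prod -h1 distrC; congr (`|_|); ring.
  by exists c => //; rewrite (le_trans hc2) // ler_norm.
Qed.

Lemma clustered_discr_ge (q : nat) (eps xi eta : R) (z : R[i]) :
  (1 < q)%N -> 0 < xi -> 0 < eps -> eps <= eta -> ln eps + 3 <= ln eta ->
  clustered q (floquet_spectrum V q) eps xi -> cIm z = eta ->
  expR (q%:R `^ xi) <= Normc.normc (discr V q z).
Proof.
move=> q1 xi0 eps0 eps_eta ln_eta [k [a [b [_ triv ab cover card]]]] hz.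
have q0 : (0 < q)%N by exact: ltnW.
have eta0 : 0 < eta by exact: lt_le_trans eps_eta.
have [rs [srs hrs]] : exists rs : seq R, size rs = q /\
    forall z, discr V q z - ('i + conjc 'i) = \prod_(r <- rs) (z - r%:C).
  apply: discr_split => //.
  by apply/eqP; rewrite eq_complex /=; apply/andP; split; apply/eqP; ring.
have hrs0 w : discr V q w = \prod_(r <- rs) (w - r%:C).
  rewrite -hrs (_ : 'i + conjc 'i = 0) ?subr0 //.
  by apply/eqP; rewrite eq_complex /= addr0 subrr !eqxx.
have hrsR x : rdiscr V q x = \prod_(r <- rs) (x - r).
  apply: (@complexI R); rewrite rdiscrE hrs0 rmorph_prod.
  by apply: eq_bigr => r _; rewrite rmorphB.
have specP x : floquet_spectrum V q x <-> x \in rs.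
  rewrite floquet_spectrumP // hrsR; split.
    move=> /eqP; rewrite prodf_seq_eq0 => /hasP[r rrs /=].
    by rewrite subr_eq0 => /eqP ->.
  by move=> xrs; apply/eqP; rewrite prodf_seq_eq0; apply/hasP; exists x; rewrite //= subrr.
pose J j := floquet_spectrum V q `&` `[a j, b j]%classic.
have finJ j : finite_set (J j).
  apply: (@sub_finite_set _ _ [set` rs]); last exact: finite_seq.
  by move=> x [/specP].
have memJ j x : (x \in fset_set (J j)) = (x \in rs) && (a j <= x <= b j).
  rewrite in_fset_set //; apply/idP/idP.
    by rewrite inE => -[/specP -> /=]; rewrite in_itv.
  by move=> /andP[h1 h2]; rewrite inE; split; [exact/specP|rewrite /= in_itv].
(* Every cluster thus holds two distinct zeros, and [rdiscr_hump] yields a point between them where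
   the discriminant is at least 1 in modulus, so that the sum of logarithms there is nonnegative. *)
have qxi1 : 1 < q%:R `^ xi :> R.
  have := @gt0_ltr_powR R _ xi0 1 q%:R; rewrite powR1; apply.
  - by rewrite nnegrE.
  - by rewrite nnegrE.
  - by rewrite ltr1n.
have hump j : exists c, (a j <= c <= b j) && (1 <= `|rdiscr V q c|).
  have : (1 < #|` fset_set (J j)|)%N.
    by rewrite -(ltr1n R); exact: lt_le_trans qxi1 (card j).
  have : forall x, (x \in enum_fset (fset_set (J j))) = (x \in rs) && (a j <= x <= b j).
    exact: memJ.
  have := fset_uniq (fset_set (J j)).
  case: (enum_fset (fset_set (J j))) => [|x [|y s]] //= /andP[+ _] + _.
  rewrite inE negb_or => /andP[xy _] mem.
  have := mem x; rewrite inE eqxx /= => /esym/andP[xrs /andP[ax xb]].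
  have := mem y; rewrite !inE eqxx orbT /= => /esym/andP[yrs /andP[ay yb]].
  have z0 t : t \in rs -> rdiscr V q t = 0 by move=> /specP/floquet_spectrumP; apply.
  move: xy; rewrite neq_lt => /orP[xy|xy].
    have [c /andP[? ?] hc] := rdiscr_hump q0 xy (z0 _ xrs) (z0 _ yrs).
    by exists c; apply/andP; split; [apply/andP; split|]; lra.
  have [c /andP[? ?] hc] := rdiscr_hump q0 xy (z0 _ yrs) (z0 _ xrs).
  by exists c; apply/andP; split; [apply/andP; split|]; lra.
have [c hc] := choice hump.
have cI j : a j <= c j <= b j by case/andP: (hc j).
have c1 j : 1 <= `|rdiscr V q (c j)| by case/andP: (hc j).
have cr j r : r \in rs -> c j != r.
  move=> rrs; apply/eqP => e; have := c1 j; rewrite e.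
  have -> : rdiscr V q r = 0 by have /specP/floquet_spectrumP := rrs; apply.
  by rewrite normr0 ler10.
have csum j : 0 <= \sum_(r <- rs) ln `|c j - r|.
  rewrite -ln_prod => [|r rrs]; last by rewrite normr_gt0 subr_eq0 cr.
  by rewrite -normr_prod -hrsR ln_ge0.
have ccount j : q%:R `^ xi <= (count (fun r => a j <= r <= b j) rs)%:R :> R.
  apply: (le_trans (card j)); rewrite ler_nat -size_filter.
  apply: uniq_leq_size; first exact: fset_uniq.
  by move=> x; rewrite memJ mem_filter andbC.
have disj i j t : a i <= t <= b i -> a j <= t <= b j -> i = j.
  by move=> ti tj; apply: triv => //; exists t; split; rewrite /= in_itv.
have cov r : r \in rs -> exists j, a j <= r <= b j.
  by move=> /specP/cover[j _]; rewrite /= in_itv => ?; exists j.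
have len j : b j - a j <= eps by case: (ab j).
set E := cRe z.
have -> : Normc.normc (discr V q z) = \prod_(r <- rs) Num.sqrt ((E - r) ^+ 2 + eta ^+ 2).
  rewrite hrs0 normc_prod; apply: eq_bigr => r _.
  by rewrite /E -hz; case: (z) => x y /=; rewrite subr0.
have pos r : 0 < Num.sqrt ((E - r) ^+ 2 + eta ^+ 2).
  by rewrite sqrtr_gt0 ltr_wpDl ?sqr_ge0 ?exprn_gt0.
rewrite -[X in _ <= X]lnK ?posrE ?prodr_gt0 // ler_expR ln_prod //.
change (q%:R `^ xi <= \sum_(r <- rs) lnmod eta (E - r)).
have [j0 _] : exists j : 'I_k, True.
  case: rs srs cov {hrs hrs0 hrsR specP finJ memJ hump cr csum ccount hc c1 pos} => [|r s].
    by move=> /= e; rewrite -e in q0.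
  by move=> _ /(_ r (mem_head _ _))[j _]; exists j.
(* Three positions of [E]: left of all chosen points, right of all of them, or between neighbours
   [c j <= E < c j']. *)
have [[i1 hi1]|noleft] := pselect (exists j, c j <= E); last first.
  have right j : E < c j.
    by rewrite ltNge; apply/negP => h; apply: noleft; exists j.
  case: (@arg_minP _ _ _ j0 predT c isT) => j _ jmin.
  apply: (one_cluster_bound eta0 ln_eta (len j) (cI j) (cr j) (csum j) (ccount j)).
  move=> r rrs rI; have [i /andP[ri1 ri2]] := cov r rrs.
  have cjr : c j < r.
    rewrite ltNge; apply/negP => rc; move/negP: rI; apply.
    have ij : i = j.
      apply: (disj _ _ (c j)) => //.
      have := jmin i isT => h; have /andP[? ?] := cI i.
      by apply/andP; split; lra.
    by subst i; rewrite ri1.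
  have := right j => ?; rewrite !ler0_norm; lra.
case: (@arg_maxP _ _ _ i1 (fun j => c j <= E) c hi1) => j hj jmax.
have leftof r i : a i <= r <= b i -> c i <= E -> i != j -> r < c j.
  move=> /andP[ri1 ri2] ciE /eqP ij; rewrite ltNge; apply/negP => h; apply: ij.
  apply: (disj _ _ (c j)) => //.
  have := jmax i ciE => h'; have /andP[? ?] := cI i.
  by apply/andP; split; [rewrite (le_trans _ h')|lra].
have [[i2 hi2]|noright] := pselect (exists j, E < c j); last first.
  have left i : c i <= E.
    by rewrite leNgt; apply/negP => h; apply: noright; exists i.
  apply: (one_cluster_bound eta0 ln_eta (len j) (cI j) (cr j) (csum j) (ccount j)).
  move=> r rrs rI; have [i ri] := cov r rrs.
  have cjr : r < c j.
    by apply: (leftof _ _ ri (left i)); apply: contraNneq rI => <-.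
  have := left j => ?; rewrite !ger0_norm; lra.
case: (@arg_minP _ _ _ i2 (fun j => E < c j) c hi2) => j' hj' jmin.
have b1a2 : b j < a j'.
  rewrite ltNge; apply/negP => h.
  have /andP[? ?] := cI j; have /andP[? ?] := cI j'.
  have e : j = j'.
    have [aa|aa] := leP (a j) (a j').
      by apply: (disj _ _ (a j')); apply/andP; split; lra.
    by apply: (disj _ _ (a j)); apply/andP; split; lra.
  by move: hj hj'; rewrite -e => ? ?; lra.
apply: (two_cluster_bound eta0 ln_eta (len j) (cI j) (len j') (cI j') b1a2 eps_eta
  (cr j) (cr j') (csum j) (csum j') (ccount j) (ccount j')).
  by rewrite hj ltW.
move=> r rrs rj rj'; have [i ri] := cov r rrs.
have [ciE|Eci] := leP (c i) E.
  by left; apply: (leftof _ _ ri ciE); apply: contraNneq rj => <-.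
right; rewrite ltNge; apply/negP => h; move/negP: rj'; apply.
have -> : j' = i; last by [].
apply: (disj _ _ (c j')) => //.
have h' : c j' <= c i by exact: jmin.
by have /andP[? ?] := cI i; move/andP: ri => [? ?]; apply/andP; split; lra.
Qed.

End ClusteredDiscriminant.

(** * Spectral measures of the truncations *)

Section JacobiSpectral.
Variable R : realType.
Variable V : nat -> R.
Local Open Scope complex_scope.

Definition jacobi_mx (N : nat) : 'M[R[i]]_N :=
  \matrix_(i < N, j < N) ((V i.+1)%:C *+ (i == j)
     + ((i.+1 == j :> nat) || (j.+1 == i :> nat))%:R).

Lemma jacobi_mx_herm N : jacobi_mx N \is hermsymmx.
Proof.
apply/is_hermitianmxP; rewrite expr0 scale1r; apply/matrixP => i j; rewrite !mxE.
transitivity (conjc ((V j.+1)%:C *+ (j == i) +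
  ((j.+1 == i :> nat) || (i.+1 == j :> nat))%:R)); last by [].
have realE (x : R) (m n : nat) : x%:C *+ m + n%:R = (x *+ m + n%:R)%:C :> R[i].
  by rewrite rmorphD rmorphMn rmorph_nat.
by rewrite orbC [j == i]eq_sym !realE conjc_real; case: eqP => [->|].
Qed.

Lemma jacobi_mx_row N (u : nat -> R[i]) (j : 'I_N) :
  u 0 = 0 -> u N.+1 = 0 ->
  ((\row_(i < N) u i.+1) *m jacobi_mx N) 0 j = u j.+2 + u j + (V j.+1)%:C * u j.+1.
Proof.
move=> hu0 huq; rewrite mxE.
pose T1 (i : 'I_N) := (V i.+1)%:C * u i.+1 * (nat_of_ord i == j)%:R.
pose T2 (i : 'I_N) := u i.+1 * (nat_of_ord i == j.-1)%:R *+ (0 < j)%N.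
pose T3 (i : 'I_N) := u i.+1 * (nat_of_ord i == j.+1)%:R.
rewrite (eq_bigr (fun i => T1 i + T2 i + T3 i)); last first.
  move=> i _; rewrite !mxE /T1 /T2 /T3.
  have -> : (i == j) = (nat_of_ord i == j) by [].
  have -> : (i.+1 == j :> nat) = (0 < j)%N && (nat_of_ord i == j.-1) by lia.
  rewrite [(j.+1 == i)%N]eq_sym.
  have excl : ~~ ((0 < j)%N && (nat_of_ord i == j.-1) && (nat_of_ord i == j.+1)) by lia.
  move: excl.
  case: (nat_of_ord i == j.-1); case: (nat_of_ord i == j.+1); case: (0 < j)%N => //= _;
  case: (nat_of_ord i == j);
  rewrite /= ?mulr0n ?mulr1n ?mulr1 ?mulr0 ?addr0 ?add0r; ring.
rewrite !big_split /= /T1 /T2 /T3 !sumrMnl.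
rewrite (sum_pick (fun n => (V n.+1)%:C * u n.+1)) !(sum_pick (fun n => u n.+1)).
rewrite (ltn_ord j) mulr1n.
have -> : (j.-1 < N)%N by exact: leq_ltn_trans (leq_pred _) (ltn_ord j).
rewrite [in RHS](_ : u j.+2 = u j.+2 *+ (j.+1 < N)%N); last first.
  have := ltn_ord j; rewrite leq_eqVlt => /orP[/eqP e|->//].
  by rewrite [X in u X.+1]e huq mul0rn.
rewrite [in RHS](_ : u j = u j.-1.+1 *+ (0 < j)%N); last first.
  by case: (nat_of_ord j) => [|n] /=; rewrite ?mulr0n.
by rewrite mulr1n; ring.
Qed.

Lemma normc_mul_le (x y : R[i]) :
  `|cRe (conjc x * y)| <= (sqnormc x + sqnormc y) / 2.
Proof.
case: x y => [a b] [c d]; rewrite /sqnormc /= ler_norml.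
apply/andP; split.
  have := sqr_ge0 (a + c); have := sqr_ge0 (b + d); rewrite !sqrrD; lra.
have := sqr_ge0 (a - c); have := sqr_ge0 (b - d); rewrite !sqrrB; lra.
Qed.

(* [r n j] is the mass at the eigenvalue [lam j] of the spectral measure of the
   pair (delta_n, delta_1) for the truncation of the operator to {1, ..., N}. *)
Lemma jacobi_spectral (N : nat) : (0 < N)%N ->
  exists (lam : 'I_N -> R) (r : nat -> 'I_N -> R),
  [/\ forall j, r 0 j = 0 /\ r N.+1 j = 0,
      forall j n, (n < N)%N ->
        r n.+2 j + r n j + V n.+1 * r n.+1 j = lam j * r n.+1 j,
      forall n, (0 < n <= N)%N -> \sum_j r n j = (n == 1%N)%:R &
      forall n, (n <= N.+1)%N -> \sum_j `|r n j| <= 1].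
Proof.
move=> N0; pose H := jacobi_mx N; pose P := spectralmx H; pose d := spectral_diag H.
have HE := orthomx_spectralP (hermitian_normalmx (jacobi_mx_herm N)).
have dreal := hermitian_spectral_diag_real (jacobi_mx_herm N).
have PH : P *m H = diag_mx d *m P.
  by rewrite [in LHS]/H HE -/H -/P -/d !mulmxA mulmxV ?spectral_unit // mul1mx.
have dE j : d 0 j = (cRe (d 0 j))%:C.
  by rewrite RRe_real //; exact: (mxOverP dreal).
have PP n m : \sum_j conjc (P j n) * P j m = (n == m)%:R.
  have := mulVmx (spectral_unit H); rewrite -/P invmx_unitary ?spectral_unitarymx //.
  move=> /matrixP/(_ n m); rewrite !mxE => <-.
  by apply: eq_bigr => j _; rewrite !mxE.
pose u n j : R[i] := if n is m.+1 then
  (if insub m is Some i then P j i else 0) else 0.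
have uE j (i : 'I_N) : u i.+1 j = P j i by rewrite /u valK.
have uN j : u N.+1 j = 0 by rewrite /u insubN // ltnn.
(* Row [j] of the unitary [P], continued by 0 at both ends, is an eigenvector. The real part keeps
   the recurrence since [V] and the eigenvalues are real. *)
pose r n j := cRe (conjc (u n j) * u 1 j).
have sqsum n : (n <= N.+1)%N -> \sum_j sqnormc (u n j) <= 1.
  case: n => [|n] nN; first by rewrite big1 // => j _; rewrite /sqnormc /= expr0n addr0.
  move: nN; rewrite ltnS leq_eqVlt => /orP[/eqP ->|nN].
    by rewrite big1 // => j _; rewrite uN /sqnormc /= expr0n addr0.
  have e : \sum_j cRe (conjc (P j (Ordinal nN)) * P j (Ordinal nN)) = 1.
    by rewrite -Re_sum PP eqxx.
  rewrite -e; apply: ler_sum => j _; rewrite (uE j (Ordinal nN)).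
  by case: (P _ _) => a b; rewrite /sqnormc /=; lra.
exists (fun j => cRe (d 0 j)), r; split.
- by move=> j; split; rewrite /r ?uN conjc0 mul0r.
- move=> j n nN; rewrite /r.
  have e : u n.+2 j + u n j + (V n.+1)%:C * u n.+1 j = d 0 j * u n.+1 j.
    rewrite -(jacobi_mx_row (u := u^~ j) (Ordinal nN)) //.
    have -> : \row_(i < N) u i.+1 j = row j P.
      by apply/rowP => i; rewrite !mxE uE.
    by rewrite -row_mul -/H PH mxE mul_diag_mx mxE -(uE j (Ordinal nN)).
  have := congr1 (fun x => cRe (conjc x * u 1 j)) e; rewrite dE.
  case: (u n.+2 j) (u n j) (u n.+1 j) (u 1 j) => [a b] [a1 b1] [a2 b2] [a3 b3] /=; lra.
- case=> // n nN; transitivity (cRe ((Ordinal nN == Ordinal N0)%:R : R[i])).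
    rewrite -PP Re_sum; apply: eq_bigr => j _.
    by rewrite /r (uE j (Ordinal nN)) (uE j (Ordinal N0)).
  by rewrite -val_eqE /= eqSS; case: eqP.
- move=> n nN; apply: le_trans (_ : \sum_j (sqnormc (u n j) + sqnormc (u 1 j)) / 2 <= _).
    by apply: ler_sum => j _; exact: normc_mul_le.
  rewrite -mulr_suml big_split /=.
  have := sqsum n nN; have := sqsum 1 (ltnW (N0 : (1 < N.+1)%N)).
  lra.
Qed.

End JacobiSpectral.

(** * Conservation of flux for the truncations *)

Section FiniteBound.
Variable R : realType.
Variable V : nat -> R.
Local Open Scope complex_scope.

Section Flux.
Variables (N : nat) (lam : 'I_N -> R) (r : nat -> 'I_N -> R) (eta : R).
Hypothesis eta0 : 0 < eta.
Hypothesis r_end : forall j, r 0 j = 0 /\ r N.+1 j = 0.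
Hypothesis r_rec : forall j n, (n < N)%N ->
  r n.+2 j + r n j + V n.+1 * r n.+1 j = lam j * r n.+1 j.
Hypothesis r_sum : forall n, (0 < n <= N)%N -> \sum_j r n j = (n == 1%N)%:R.
Hypothesis r_norm : forall n, (n <= N.+1)%N -> \sum_j `|r n j| <= 1.

(** This is [eta] times the integral over [t >= 0] of the probability at site [n] against
    [exp (- eta t)]: the kernel is [eta] times the Laplace transform of
    [cos ((lam j - lam k) t)]. *)
Definition site_mass n : R :=
  \sum_j \sum_k r n j * r n k * (eta ^+ 2 / (eta ^+ 2 + (lam j - lam k) ^+ 2)).

(** Entry [n] of the resolvent of the truncation applied to [delta_1]. *)
Definition truncated_green n (z : R[i]) : R[i] :=
  \sum_j (r n j)%:C / ((lam j)%:C - z).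

Let K j k : R := (lam j - lam k) / (eta ^+ 2 + (lam j - lam k) ^+ 2).

Lemma denom_gt0 (w : R) : 0 < eta ^+ 2 + w ^+ 2.
Proof. by rewrite ltr_pwDl ?exprn_gt0 ?sqr_ge0. Qed.

(** The kernel of [site_mass] is [1 - (lam j - lam k) * K j k]. The 1 contributes a product of total
    masses, which vanish at sites other than 1. By the recurrence, the rest is a difference of
    consecutive Wronskians [W] and telescopes; the boundary term at [N] is zero. *)
Lemma sum_site_mass q : (0 < q <= N)%N ->
  \sum_(q <= n < N) site_mass n.+1 =
  \sum_j \sum_k (r q.+1 j * r q k - r q j * r q.+1 k) * K j k.
Proof.
move=> /andP[q0 qN]; pose W n j k := r n.+1 j * r n k - r n j * r n.+1 k.
transitivity (\sum_(q <= n < N) \sum_j \sum_k (W n j k - W n.+1 j k) * K j k);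
  last first.
  rewrite exchange_big /=; apply: eq_bigr => j _.
  rewrite exchange_big /=; apply: eq_bigr => k _.
  rewrite -mulr_suml; congr (_ * _).
  rewrite (eq_bigr (fun n => (- W n.+1 j k) - (- W n j k))) => [|n _]; last by ring.
  rewrite telescope_sumr // /W.
  by have [_ ->] := r_end j; have [_ ->] := r_end k; ring.
apply: eq_big_nat => n /andP[qn nN]; rewrite /site_mass.
have z0 : \sum_j \sum_k r n.+1 j * r n.+1 k = 0.
  under eq_bigr => j _ do rewrite -mulr_sumr.
  by rewrite -mulr_suml r_sum //= eqSS gtn_eqF ?mul0r //; lia.
transitivity (\sum_j \sum_k r n.+1 j * r n.+1 k +
    \sum_j \sum_k (W n j k - W n.+1 j k) * K j k); last by rewrite z0 add0r.
rewrite -big_split; apply: eq_bigr => j _; rewrite -big_split; apply: eq_bigr => k _ /=.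
have e : W n j k - W n.+1 j k = - (lam j - lam k) * (r n.+1 j * r n.+1 k).
  have ej := r_rec j nN; have ek := r_rec k nN.
  transitivity (- ((lam j * r n.+1 j) * r n.+1 k - (lam k * r n.+1 k) * r n.+1 j)).
    by rewrite -ej -ek /W; ring.
  by ring.
rewrite e /K; field.
by rewrite gt_eqF ?denom_gt0.
Qed.

(** [K j k] is the real part of [1 / (lam j - lam k - i eta)], so the sum over [j] gives the Green
    function at [lam k + i eta]. [K] is antisymmetric, so both halves of the Wronskian contribute
    equally, whence the factor 2. *)
Lemma sum_site_mass_green q : (0 < q <= N)%N ->
  \sum_(q <= n < N) site_mass n.+1 =
  - 2 * \sum_k r q.+1 k * cRe (truncated_green q ((lam k) +i* eta)).
Proof.
move=> hq; rewrite sum_site_mass //.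
have GE k : cRe (truncated_green q ((lam k) +i* eta)) = \sum_j r q j * K j k.
  rewrite /truncated_green Re_sum; apply: eq_bigr => j _; rewrite /K /=.
  by field; rewrite ?gt_eqF ?denom_gt0 // addrC sqrrN gt_eqF ?denom_gt0.
have swap : \sum_j \sum_k (r q.+1 j * r q k) * K j k =
    - \sum_j \sum_k (r q j * r q.+1 k) * K j k.
  rewrite exchange_big -sumrN; apply: eq_bigr => j _ /=; rewrite -sumrN.
  apply: eq_bigr => k _; rewrite /K -(opprB (lam j)) sqrrN; ring.
transitivity (- 2 * \sum_j \sum_k (r q j * r q.+1 k) * K j k).
  under eq_bigr => j _ do under eq_bigr => k _ do rewrite mulrBl.
  under eq_bigr => j _ do rewrite sumrB.
  by rewrite sumrB swap; ring.
congr (_ * _); rewrite exchange_big; apply: eq_bigr => k _ /=.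
by rewrite GE mulr_sumr; apply: eq_bigr => j _; ring.
Qed.

Lemma truncated_green_le q (z : R[i]) (B : R) :
  (0 < q <= N)%N -> cIm z = eta -> 0 < B -> B <= Normc.normc (discr V q z) ->
  Normc.normc (truncated_green q z) <= (1 + 2 / eta ^+ 2) / B.
Proof.
(* [truncated_green 0 z] is 0; the value -1 in its place absorbs the source term in the recurrence
   at site 1, as [green_discr_le] expects. *)
move=> hq hz B0 hB; pose u n := if n is 0 then -1 else truncated_green n z.
have lamz j : (lam j)%:C - z != 0.
  apply/eqP => /(congr1 cIm); case: (z) hz => x y /= -> /eqP.
  by rewrite sub0r oppr_eq0 gt_eqF.
have rec n : (n < N)%N -> truncated_green n.+2 z =
    (z - potC V n.+1) * truncated_green n.+1 z - truncated_green n z + (n == 0%N)%:R.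
  move=> nN; have -> : (n == 0%N)%:R = \sum_j (r n.+1 j)%:C :> R[i].
    by rewrite -rmorph_sum r_sum // eqSS rmorph_nat.
  rewrite /truncated_green mulr_sumr -sumrB -big_split /=; apply: eq_bigr => j _.
  have -> : r n.+2 j = lam j * r n.+1 j - r n j - V n.+1 * r n.+1 j.
    by rewrite -r_rec //; ring.
  rewrite !rmorphB !rmorphM /potC; field; exact: lamz.
have := @green_discr_le _ V z u N q; rewrite hz => /(_ eta0 hq).
have -> : u q = truncated_green q z by rewrite /u; case: (q) hq.
have : u N.+1 = 0.
  by rewrite /u /truncated_green big1 // => j _; have [_ ->] := r_end j; rewrite mul0r.
move=> uN hG; have {}hG := hG _ erefl uN.
rewrite ler_pdivlMr //; apply: le_trans (ler_wpM2l (normc_ge0 _) hB) (hG _).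
move=> [|n] nN; rewrite /u rec //= ?addr0 //.
rewrite {2}/truncated_green big1 => [|j _]; last by have [-> _] := r_end j; rewrite mul0r.
by rewrite subr0 opprK.
Qed.

Lemma sum_site_mass_le q (B : R) : (0 < q <= N)%N -> 0 < B ->
  (forall z, cIm z = eta -> B <= Normc.normc (discr V q z)) ->
  \sum_(q <= n < N) site_mass n.+1 <= 2 * (1 + 2 / eta ^+ 2) / B.
Proof.
move=> hq B0 hB; rewrite sum_site_mass_green // mulNr -mulrN -mulrA ler_wpM2l //.
apply: le_trans (ler_norm _) _; rewrite normrN.
apply: le_trans (ler_norm_sum _ _ _) _; set C := _ / B.
have C0 : 0 <= C by rewrite divr_ge0 ?(ltW B0) // addr_ge0 ?divr_ge0 ?sqr_ge0.
apply: le_trans (_ : \sum_k `|r q.+1 k| * C <= _).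
  apply: ler_sum => k _; rewrite normrM ler_wpM2l //.
  apply: le_trans (Re_normc_le _) (truncated_green_le hq _ B0 _) => //.
  exact: hB.
rewrite -mulr_suml -[X in _ <= X]mul1r ler_wpM2r // r_norm //.
by case/andP: hq.
Qed.

End Flux.
End FiniteBound.

(** * Time averages *)

Section LaplaceSquare.
Variable R : realType.
Local Notation mu := (@lebesgue_measure R).

Lemma is_derive_mull (c t : R) : is_derive t 1 (fun u : R => c * u) c.
Proof.
have := @is_deriveZ _ _ _ (@id R) c t 1 1 (is_derive_id t 1).
by rewrite /GRing.scale /= mulr1.
Qed.

Lemma is_derive_expR_lin (c t : R) :
  is_derive t 1 (fun u => expR (c * u)) (c * expR (c * t)).
Proof.
have h := is_derive_mull c t.
rewrite mulrC; exact: (@is_derive1_comp _ expR (fun u => c * u) t _ _ (is_derive_expR _) h).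
Qed.

Lemma is_derive_sin_lin (c t : R) :
  is_derive t 1 (fun u => sin (c * u)) (c * cos (c * t)).
Proof.
have h := is_derive_mull c t.
rewrite mulrC; exact: (@is_derive1_comp _ sin (fun u => c * u) t _ _ (is_derive_sin _) h).
Qed.

Lemma is_derive_cos_lin (c t : R) :
  is_derive t 1 (fun u => cos (c * u)) (- (c * sin (c * t))).
Proof.
have h := is_derive_mull c t.
rewrite mulrC -mulNr.
exact: (@is_derive1_comp _ cos (fun u => c * u) t _ _ (is_derive_cos _) h).
Qed.

Variable eta : R.
Hypothesis eta0 : 0 < eta.

(** The primitive that tends to 0 at infinity, so only its value at 0 enters the half-line
    integral. *)
Definition laplace_cos_primitive (w t : R) : R :=
  (w * sin (w * t) - eta * cos (w * t)) * expR (- eta * t) / (eta ^+ 2 + w ^+ 2).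

Lemma is_derive_laplace_cos (w t : R) :
  is_derive t 1 (laplace_cos_primitive w) (cos (w * t) * expR (- eta * t)).
Proof.
have d1 := @is_deriveZ _ _ _ _ w t 1 _ (is_derive_sin_lin w t).
have d2 := @is_deriveZ _ _ _ _ eta t 1 _ (is_derive_cos_lin w t).
have d3 := @is_deriveM _ _ _ _ t 1 _ _ (@is_deriveB _ _ _ _ _ t 1 _ _ d1 d2)
  (is_derive_expR_lin (- eta) t).
have := @is_deriveZ _ _ _ _ (eta ^+ 2 + w ^+ 2)^-1 t 1 _ d3.
rewrite (_ : _ \*: _ = laplace_cos_primitive w); last first.
  by apply/funext => u; rewrite /laplace_cos_primitive /= /GRing.scale /= mulrC.
move=> h; apply: (is_derive_eq h); rewrite /GRing.scale /=.
rewrite [X in _ * (X * _ + _)](_ : _ = w * sin (w * t) - eta * cos (w * t)) //.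
by field; rewrite gt_eqF // denom_gt0.
Qed.

Lemma cvg_laplace_cos (w : R) : laplace_cos_primitive w t @[t --> +oo] --> 0.
Proof.
pose C := (`|w| + eta) / (eta ^+ 2 + w ^+ 2).
have C0 : 0 <= C by rewrite divr_ge0 ?addr_ge0 ?sqr_ge0 ?(ltW eta0).
have hexp : C * expR (- eta * t) @[t --> +oo] --> 0.
  rewrite -(mulr0 C); apply: cvgMr.
  rewrite (_ : (fun t => _) = (fun z => expR (- z)) \o (fun z => eta * z)); last first.
    by apply: eq_fun => x; rewrite mulNr.
  apply: (@cvg_comp _ _ _ _ _ _ (pinfty_nbhs R)); last exact: cvgr_expR.
  exact: gt0_cvgMry.
apply/cvgr0Pnorm_le => e e0.
move/cvgr0Pnorm_le/(_ e e0): hexp; apply: filterS => t; apply: le_trans.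
have D0 := denom_gt0 eta0 w.
rewrite [X in _ <= X]ger0_norm; last exact: mulr_ge0 C0 (expR_ge0 _).
rewrite /C.
rewrite /laplace_cos_primitive !normrM normfV (ger0_norm (expR_ge0 _)).
rewrite (gtr0_norm D0) mulrAC.
rewrite ler_wpM2r ?expR_ge0 // ler_wpM2r ?invr_ge0 ?(ltW D0) //.
apply: le_trans (ler_normB _ _) _; rewrite !normrM (gtr0_norm eta0).
apply: lerD; rewrite -[X in _ <= X]mulr1 ler_wpM2l ?(ltW eta0) //.
  by rewrite ler_norml sin_geN1 sin_le1.
by rewrite ler_norml cos_geN1 cos_le1.
Qed.

Variables (N : nat) (lam x : 'I_N -> R).

(** The squared modulus of the sum of [x j * exp (- i lam j t)]. *)
Definition wave_sq (t : R) : R :=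
  (\sum_j x j * cos (lam j * t)) ^+ 2 + (\sum_j x j * sin (lam j * t)) ^+ 2.

Lemma wave_sqE t :
  wave_sq t = \sum_j \sum_k x j * x k * cos ((lam j - lam k) * t).
Proof.
rewrite /wave_sq !expr2 !mulr_suml -big_split; apply: eq_bigr => j _ /=.
rewrite !mulr_sumr -big_split; apply: eq_bigr => k _ /=.
by rewrite mulrBl cosB; ring.
Qed.

Lemma wave_sq_ge0 t : 0 <= wave_sq t.
Proof. by rewrite addr_ge0 ?sqr_ge0. Qed.

Let F (t : R) : R := \sum_j \sum_k x j * x k * laplace_cos_primitive (lam j - lam k) t.

Lemma is_derive_wave (t : R) : is_derive t 1 F (wave_sq t * expR (- eta * t)).
Proof.
rewrite (_ : F = \sum_j \sum_k
    ((x j * x k) \*: laplace_cos_primitive (lam j - lam k))); last first.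
  apply/funext => u; rewrite fct_sumE; apply: eq_bigr => j _.
  by rewrite fct_sumE; apply: eq_bigr.
have d j k := @is_deriveZ _ _ _ _ (x j * x k) t 1 _ (is_derive_laplace_cos (lam j - lam k) t).
have h := @is_derive_sum _ _ _ _ _ t 1 _ (fun j => @is_derive_sum _ _ _ _ _ t 1 _ (d j)).
apply: (is_derive_eq h); rewrite wave_sqE mulr_suml; apply: eq_bigr => j _.
rewrite mulr_suml; apply: eq_bigr => k _.
by rewrite /GRing.scale /=; ring.
Qed.

Lemma continuous_wave : continuous (fun t => wave_sq t * expR (- eta * t)).
Proof.
move=> t; apply: cvgM.
  rewrite (_ : wave_sq = fun t =>
    \sum_j \sum_k x j * x k * cos ((lam j - lam k) * t)); last first.
    by apply/funext => u; exact: wave_sqE.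
  move: t; apply: (continuous_big (op := +%R)) => [|j _]; first exact: add_continuous.
  apply: (continuous_big (op := +%R)) => [|k _]; first exact: add_continuous.
  move=> t; apply: cvgMr; apply/differentiable_continuous/derivable1_diffP.
  by have [] := is_derive_cos_lin (lam j - lam k) t.
apply: (@differentiable_continuous _ _ _ _ (fun u => expR (- eta * u))).
by apply/derivable1_diffP; have [] := is_derive_expR_lin (- eta) t.
Qed.

Lemma integral_wave :
  (\int[mu]_(t in `[0%R, +oo[) (wave_sq t * expR (- eta * t))%:E =
  (\sum_j \sum_k x j * x k * (eta / (eta ^+ 2 + (lam j - lam k) ^+ 2)))%:E)%E.
Proof.
have dF t : derivable F t 1 by have [] := is_derive_wave t.
rewrite (@ge0_continuous_FTC2y _ _ F 0 0).
- rewrite sub0e -EFinN; congr (_%:E); rewrite /F -sumrN; apply: eq_bigr => j _.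
  rewrite -sumrN; apply: eq_bigr => k _; rewrite /laplace_cos_primitive.
  by rewrite !mulr0 sin0 cos0 expR0; ring.
- by move=> t _; rewrite mulr_ge0 ?wave_sq_ge0 ?expR_ge0.
- exact/continuous_subspaceT/continuous_wave.
- rewrite (_ : 0 = \sum_(j < N) \sum_(k < N) 0 :> R); last first.
    by rewrite big1 // => j _; rewrite big1.
  apply: (cvg_big (op := +%R)) => [|j _]; first exact: add_continuous.
  apply: (cvg_big (op := +%R)) => [|k _]; first exact: add_continuous.
  by rewrite -(mulr0 (x j * x k)); apply: cvgMr; exact: cvg_laplace_cos.
- by move=> t _.
- apply/cvg_at_right_filter; apply/differentiable_continuous/derivable1_diffP.
  exact: dF.
- move=> t _; rewrite derive1E; have h := is_derive_wave t.
  exact: derive_val.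
Qed.

End LaplaceSquare.

(** * Convergence of the truncated evolutions *)

Section Evolution.
Variable R : realType.
Variable V : nat -> R.
Local Open Scope complex_scope.
Local Notation mu := (@lebesgue_measure R).

Section DominatedSeries.
Variables (x K : R) (x0 : 0 <= x) (K0 : 0 <= K).
Variable a : nat -> R.
Hypothesis ha : forall k, `|a k| <= exp_coeff x k.

Lemma dominated_term (m : nat -> R) k :
  `|m k| <= K ^+ k -> `|a k * m k| <= exp_coeff (x * K) k.
Proof.
move=> hm; rewrite normrM /exp_coeff /= exprMn mulrAC.
by apply: ler_pM => //; exact: ha.
Qed.

Lemma dominated_series_cvg (m : nat -> R) :
  (forall k, `|m k| <= K ^+ k) -> cvgn (series (fun k => a k * m k)).
Proof.
move=> hm; apply: normed_cvg; apply: (@series_le_cvg _ _ (exp_coeff (x * K))).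
- by move=> n; exact: normr_ge0.
- by move=> n; apply: exp_coeff_ge0; exact: mulr_ge0 x0 K0.
- by move=> n; exact: dominated_term.
- exact: is_cvg_series_exp_coeff.
Qed.

Definition exp_tail (y : R) (L : nat) : R := expR y - series (exp_coeff y) L.

Lemma cvg_exp_tail (y : R) : exp_tail y @ \oo --> 0.
Proof.
rewrite -(subrr (expR y)); apply: cvgB; first exact: cvg_cst.
rewrite /expR; exact: is_cvg_series_exp_coeff.
Qed.

(** Only the terms from [L] on differ, and each difference is at most twice the corresponding term
    of the series of [expR (x * K)]. *)
Lemma dominated_series_close (m m' : nat -> R) (L : nat) :
  (forall k, `|m k| <= K ^+ k) -> (forall k, `|m' k| <= K ^+ k) ->
  (forall k, (k < L)%N -> m k = m' k) ->
  `|limn (series (fun k => a k * m k)) - limn (series (fun k => a k * m' k))| <=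
  2 * exp_tail (x * K) L.
Proof.
move=> hm hm' e; have c := dominated_series_cvg hm; have c' := dominated_series_cvg hm'.
rewrite -limB //; set u := (_ - _).
have cu : cvgn u by exact: is_cvgB.
rewrite -lim_norm //; apply: limr_le; first exact: is_cvg_norm.
near=> n; have Ln : (L <= n)%N by near: n; exists L.
rewrite (_ : u n = \sum_(0 <= k < n) (a k * m k - a k * m' k)); last first.
  by rewrite sumrB.
rewrite (big_cat_nat (n := L)) //= big_nat big1 ?add0r; last first.
  by move=> k /andP[_ kL]; rewrite e // subrr.
apply: le_trans (ler_norm_sum _ _ _) _.
apply: le_trans (_ : \sum_(L <= k < n) 2 * exp_coeff (x * K) k <= _).
  apply: ler_sum => k _; apply: le_trans (ler_normB _ _) _.
  rewrite mulr2n mulrDl mul1r; apply: lerD; exact: dominated_term.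
rewrite -mulr_sumr ler_wpM2l // /exp_tail lerBrDl.
rewrite /series /= -(big_cat_nat (n := L)) //=.
apply: nondecreasing_cvgn_le; last exact: is_cvg_series_exp_coeff.
by apply/nondecreasing_series => k _ _; apply: exp_coeff_ge0; exact: mulr_ge0 x0 K0.
Unshelve. all: by end_near. Qed.

End DominatedSeries.

(** The entry [n] of [H^k delta_1], which is real. *)
Fixpoint moment (k n : nat) : R :=
  if k is k'.+1 then
    match n with
    | 0 => 0
    | 1 => moment k' 2 + V 1 * moment k' 1
    | _ => moment k' n.+1 + moment k' n.-1 + V n * moment k' n
    end
  else (n == 1%N)%:R.

Lemma iter_schrodinger (c : R[i]) k :
  iter k (fun psi n => c * schrodinger V psi n) (delta R 1) =
  fun n => c ^+ k * (moment k n)%:C.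
Proof.
elim: k => [|k IH]; apply/funext => n.
  by rewrite /= expr0 mul1r /delta rmorph_nat.
rewrite iterS IH exprS; case: n => [|[|n]] /=; first by rewrite !mulr0.
  by rewrite rmorphD rmorphM; ring.
by rewrite !rmorphD rmorphM; ring.
Qed.

(** The powers of [- 'i], written with the signs of [cos_coeff] and [sin_coeff] so that the
    exponential series splits term by term. *)
Definition trig_pow (k : nat) : R[i] :=
  ((~~ odd k)%:R * (-1) ^+ k./2) +i* (- ((odd k)%:R * (-1) ^+ k.-1./2)).

Lemma Ni_expr k : (- 'i : R[i]) ^+ k = trig_pow k.
Proof.
have e2 (m : nat) : (- 'i : R[i]) ^+ m.*2 = ((-1) ^+ m)%:C.
  by rewrite -mul2n exprM sqrrN sqr_i rmorphXn rmorphN1.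
have hp : odd k -> k.-1./2 = k./2 by lia.
rewrite /trig_pow -{1}(odd_double_half k); case: (odd k) hp => /= [-> //|_].
  rewrite add1n exprS e2.
  by apply/eqP; rewrite eq_complex /=; apply/andP; split; apply/eqP; ring.
rewrite add0n e2.
by apply/eqP; rewrite eq_complex /=; apply/andP; split; apply/eqP; ring.
Qed.

Lemma cvg_complex (u v : nat -> R) (a b : R) :
  u @ \oo --> a -> v @ \oo --> b ->
  (fun n => u n +i* v n : R[i]^o) @ \oo --> (a +i* b : R[i]^o).
Proof.
move=> ua vb; apply/cvgrPdist_lt => e e0.
(* The norm of [R[i]] is complex-valued, and [0 < e] means that [e] is real and positive. *)
have [e1 ee] : 0 < cRe e /\ e = (cRe e)%:C.
  by move: e0; case: (e) => x y; rewrite ltcE /= => /andP[/eqP -> ->].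
have e2 : 0 < cRe e / 2 by rewrite divr_gt0.
near=> n; rewrite ee normc_def ltcR.
have h1 : `|a - u n| < cRe e / 2 by near: n; move/cvgrPdist_lt: ua; apply.
have h2 : `|b - v n| < cRe e / 2 by near: n; move/cvgrPdist_lt: vb; apply.
rewrite /= -(gtr0_norm e1) -sqrtr_sqr ltr_sqrt ?exprn_gt0 //.
rewrite -(real_normK (num_real (a - u n))) -(real_normK (num_real (b - v n))).
by have := normr_ge0 (a - u n); have := normr_ge0 (b - v n); nra.
Unshelve. all: by end_near. Qed.

Lemma cvg_limC (u : nat -> R[i]^o) (l : R[i]^o) : u @ \oo --> l -> limn u = l.
Proof. exact: (cvg_lim (@norm_hausdorff _ _)). Qed.

Variables (K : R) (K2 : 2 <= K) (hK : forall n, (1 <= n)%N -> `|V n| <= K - 2).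

(** The absolute row sums of [H] are at most [2 + (K - 2)]; the same [K] serves for every
    truncation. *)
Lemma moment_step_le (x y z : R) n B : (1 <= n)%N ->
  `|x| <= B -> `|y| <= B -> `|z| <= B -> `|x + y + V n * z| <= K * B.
Proof.
move=> n1 hx hy hz; apply: le_trans (ler_normD _ _) _; rewrite normrM.
have := ler_normD x y; have := ler_pM (normr_ge0 _) (normr_ge0 _) (hK n1) hz.
nra.
Qed.

Lemma moment_le k n : `|moment k n| <= K ^+ k.
Proof.
have K0 : 0 <= K by exact: le_trans K2.
elim: k n => [|k IH] [|[|n]] /=; rewrite ?expr0 ?normr0 ?normr1 ?exprn_ge0 //.
  have := @moment_step_le (moment k 2) 0 (moment k 1) 1 (K ^+ k) isT.
  by rewrite addr0 -exprS normr0; apply=> //; exact: exprn_ge0.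
by rewrite exprS moment_step_le.
Qed.

Lemma sin_coeff_le (t : R) k : `|sin_coeff t k| <= exp_coeff `|t| k.
Proof.
rewrite /sin_coeff /exp_coeff /= !normrM normfV normrX.
rewrite (ger0_norm (ler0n _ _)) normrX normrN1 expr1n mulr1 (ger0_norm (ler0n R k`!)).
rewrite ler_wpM2r ?invr_ge0 // -[X in _ <= X]mul1r ler_wpM2r ?exprn_ge0 //.
by case: odd.
Qed.

Lemma cos_coeff_le (t : R) k : `|cos_coeff t k| <= exp_coeff `|t| k.
Proof.
rewrite /cos_coeff /exp_coeff /= !normrM normfV normrX.
rewrite (ger0_norm (ler0n _ _)) normrX normrN1 expr1n mulr1 (ger0_norm (ler0n R k`!)).
rewrite ler_wpM2r ?invr_ge0 // -[X in _ <= X]mul1r ler_wpM2r ?exprn_ge0 //.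
by case: odd.
Qed.

Definition cos_series (m : nat -> R) (t : R) := limn (series (fun k => cos_coeff t k * m k)).
Definition sin_series (m : nat -> R) (t : R) := limn (series (fun k => sin_coeff t k * m k)).

Lemma evolutionE t n :
  evolution V t n = cos_series (moment^~ n) t +i* (- sin_series (moment^~ n) t).
Proof.
have K0 : 0 <= K by exact: le_trans K2.
have cc := dominated_series_cvg (normr_ge0 t) K0 (cos_coeff_le t) (moment_le^~ n).
have cs := dominated_series_cvg (normr_ge0 t) K0 (sin_coeff_le t) (moment_le^~ n).
rewrite /evolution /exp_op; apply: cvg_limC.
rewrite (_ : series _ = (fun m : nat => series (fun k => cos_coeff t k * moment k n) m +i*
   (- series (fun k => sin_coeff t k * moment k n) m)) :> (nat -> R[i]^o)).
  by apply: cvg_complex => //; exact: cvgN.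
apply/funext => m; rewrite /series /=.
elim: m => [|m IH].
  by rewrite !big_geq //; apply/eqP; rewrite eq_complex /= oppr0 !eqxx.
rewrite !big_nat_recr //= IH (iter_schrodinger (- 'i * t%:C)) exprMn Ni_expr.
rewrite -rmorphXn -[X in _ / X](rmorph_nat (real_complex R)) -fmorphV.
rewrite /trig_pow /cos_coeff /sin_coeff /= -[(-1) ^ m./2]exprnP.
by apply/eqP; rewrite eq_complex /=; apply/andP; split; apply/eqP; ring.
Qed.

Section Truncation.
Variables (N : nat) (lam : 'I_N -> R) (r : nat -> 'I_N -> R).
Hypothesis r_end : forall j, r 0 j = 0 /\ r N.+1 j = 0.
Hypothesis r_rec : forall j n, (n < N)%N ->
  r n.+2 j + r n j + V n.+1 * r n.+1 j = lam j * r n.+1 j.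
Hypothesis r_sum : forall n, (0 < n <= N)%N -> \sum_j r n j = (n == 1%N)%:R.

Definition trunc_moment (k n : nat) : R := \sum_j r n j * lam j ^+ k.

Lemma trunc_momentS k n : (n < N)%N ->
  trunc_moment k.+1 n.+1 =
  trunc_moment k n.+2 + trunc_moment k n + V n.+1 * trunc_moment k n.+1.
Proof.
move=> nN; rewrite /trunc_moment mulr_sumr -!big_split; apply: eq_bigr => j _ /=.
rewrite exprS mulrA [r n.+1 j * _]mulrC -r_rec //; ring.
Qed.

Lemma trunc_moment_end k : trunc_moment k 0 = 0 /\ trunc_moment k N.+1 = 0.
Proof.
by split; rewrite /trunc_moment big1 // => j _; have [h0 h1] := r_end j; rewrite ?h0 ?h1 mul0r.
Qed.

Lemma trunc_moment_le k n : (n <= N.+1)%N -> `|trunc_moment k n| <= K ^+ k.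
Proof.
have K0 : 0 <= K by exact: le_trans K2.
elim: k n => [|k IH] n nN.
  rewrite expr0; have [n0|n0] := posnP n.
    by rewrite n0 (trunc_moment_end 0).1 normr0.
  move: nN; rewrite leq_eqVlt => /orP[/eqP ->|nN].
    by rewrite (trunc_moment_end 0).2 normr0.
  rewrite /trunc_moment (eq_bigr (r n)) => [|j _]; last by rewrite expr0 mulr1.
  by rewrite r_sum ?n0 //; case: eqP; rewrite ?normr1 ?normr0.
case: n nN => [|n] nN; first by rewrite (trunc_moment_end _).1 normr0 exprn_ge0.
move: nN; rewrite ltnS leq_eqVlt => /orP[/eqP ->|nN].
  by rewrite (trunc_moment_end _).2 normr0 exprn_ge0.
rewrite trunc_momentS // exprS moment_step_le // IH //; lia.
Qed.

(** Each application of [H] reaches only neighbouring sites, so the cut at [N] is not felt at site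
    [n] as long as [n + k <= N]. *)
Lemma trunc_moment_eq k n : (n + k <= N)%N -> moment k n = trunc_moment k n.
Proof.
elim: k n => [|k IH] [|n] nk.
- by rewrite (trunc_moment_end 0).1.
- rewrite /trunc_moment (eq_bigr (r n.+1)) => [|j _]; last by rewrite expr0 mulr1.
  by rewrite r_sum //=; lia.
- by rewrite (trunc_moment_end _).1.
rewrite trunc_momentS; last lia.
rewrite -!IH; try lia.
case: n nk => [|n] nk //=; rewrite (IH 0); last lia.
by rewrite (trunc_moment_end _).1 addr0.
Qed.

Lemma trunc_series (c : R -> nat -> R) (f : R -> R) n t :
  (forall x k, c (x * t) k = c t k * x ^+ k) ->
  (forall x, series (c x) @ \oo --> f x) ->
  limn (series (fun k => c t k * trunc_moment k n)) = \sum_j r n j * f (lam j * t).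
Proof.
move=> hc hf; apply/cvg_lim => //.
rewrite (_ : series _ = fun m => \sum_j r n j * series (c (lam j * t)) m); last first.
  apply/funext => m; rewrite /series /=.
  under eq_bigr => k _ do rewrite /trunc_moment mulr_sumr.
  rewrite exchange_big /=; apply: eq_bigr => j _; rewrite mulr_sumr.
  by apply: eq_bigr => k _; rewrite hc; ring.
apply: (cvg_big (op := +%R)) => [|j _]; first exact: add_continuous.
by apply: cvgMr; exact: hf.
Qed.

Lemma trunc_cos_series n t :
  cos_series (trunc_moment^~ n) t = \sum_j r n j * cos (lam j * t).
Proof.
apply: (@trunc_series cos_coeff) => [x k|x].
  by rewrite /cos_coeff /= exprMn; ring.
by rewrite cos.unlock; exact: is_cvg_series_cos_coeff.
Qed.

Lemma trunc_sin_series n t :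
  sin_series (trunc_moment^~ n) t = \sum_j r n j * sin (lam j * t).
Proof.
apply: (@trunc_series sin_coeff) => [x k|x].
  by rewrite /sin_coeff /= exprMn; ring.
by rewrite sin.unlock; exact: is_cvg_series_sin_coeff.
Qed.

Lemma trunc_close n t : (n <= N)%N ->
  `|cos_series (moment^~ n) t - \sum_j r n j * cos (lam j * t)| <=
    2 * exp_tail (`|t| * K) (N - n).+1 /\
  `|sin_series (moment^~ n) t - \sum_j r n j * sin (lam j * t)| <=
    2 * exp_tail (`|t| * K) (N - n).+1.
Proof.
move=> nN; have K0 : 0 <= K by exact: le_trans K2.
have e k : (k < (N - n).+1)%N -> moment k n = trunc_moment k n.
  by move=> kN; apply: trunc_moment_eq; lia.
split; [rewrite -trunc_cos_series|rewrite -trunc_sin_series].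
  apply: (dominated_series_close (normr_ge0 t) K0 (cos_coeff_le t)) => //.
    by move=> k; exact: moment_le.
  by move=> k; apply: trunc_moment_le; exact: leqW.
apply: (dominated_series_close (normr_ge0 t) K0 (sin_coeff_le t)) => //.
  by move=> k; exact: moment_le.
by move=> k; apply: trunc_moment_le; exact: leqW.
Qed.

End Truncation.
End Evolution.

(** * Passage to the limit and the bound on the outside probability *)

Section OutsideProbability.
Variable R : realType.
Variable V : nat -> R.
Local Open Scope complex_scope.
Local Notation mu := (@lebesgue_measure R).
Variables (K : R) (K2 : 2 <= K) (hK : forall n, (1 <= n)%N -> `|V n| <= K - 2).
Variables (q : nat) (q0 : (0 < q)%N) (eta B : R) (eta0 : 0 < eta) (B0 : 0 < B).
Hypothesis hB : forall z : R[i], cIm z = eta -> B <= Normc.normc (discr V q z).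

Lemma truncated_evolution (N : nat) : (q <= N)%N ->
  exists c s : nat -> R -> R,
  [/\ forall n, continuous (fun t => (c n t ^+ 2 + s n t ^+ 2) * expR (- eta * t)),
      forall n t, (n <= N)%N ->
        `|cos_series ((moment V)^~ n) t - c n t| <= 2 * exp_tail (`|t| * K) (N - n).+1 /\
        `|sin_series ((moment V)^~ n) t - s n t| <= 2 * exp_tail (`|t| * K) (N - n).+1 &
      forall m, (m <= N)%N ->
        (\sum_(q <= n < m) \int[mu]_(t in `[0%R, +oo[)
          ((c n.+1 t ^+ 2 + s n.+1 t ^+ 2) * expR (- eta * t))%:E <=
        (2 * (1 + 2 / eta ^+ 2) / B / eta)%:E)%E].
Proof.
move=> qN; have N0 : (0 < N)%N by exact: leq_trans qN.
have [lam [r [r_end r_rec r_sum r_norm]]] := jacobi_spectral V N0.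
exists (fun n t => \sum_j r n j * cos (lam j * t)), (fun n t => \sum_j r n j * sin (lam j * t)).
split.
- by move=> n; exact: (@continuous_wave _ eta N lam (r n)).
- by move=> n t nN; exact: (trunc_close K2 hK r_end r_rec r_sum).
move=> m mN; have intE n : (\int[mu]_(t in `[0%R, +oo[)
    (((\sum_j r n j * cos (lam j * t)) ^+ 2 + (\sum_j r n j * sin (lam j * t)) ^+ 2)
      * expR (- eta * t))%:E)%E = (site_mass lam r eta n / eta)%:E.
  rewrite (integral_wave eta0 lam (r n)); congr (_%:E).
  rewrite /site_mass mulr_suml; apply: eq_bigr => j _.
  rewrite mulr_suml; apply: eq_bigr => k _.
  by field; rewrite !gt_eqF ?denom_gt0.
under eq_bigr => n _ do rewrite intE.
have mass0 n : 0 <= site_mass lam r eta n / eta.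
  rewrite -lee_fin -intE; apply: integral_ge0 => t _.
  by rewrite lee_fin mulr_ge0 ?expR_ge0 // addr_ge0 ?sqr_ge0.
rewrite sumEFin lee_fin; have [qm|mq] := leqP q m; last first.
  rewrite big_geq 1?ltnW // ltW // !divr_gt0 // mulr_gt0 //.
  by rewrite ltr_pwDl // divr_ge0 // sqr_ge0.
apply: le_trans (_ : \sum_(q <= n < N) site_mass lam r eta n.+1 / eta <= _).
  rewrite [X in _ <= X](big_cat_nat (n := m)) //= lerDl; apply: sumr_ge0 => n _.
  exact: mass0.
rewrite -mulr_suml ler_pM2r ?invr_gt0 //.
apply: (sum_site_mass_le eta0 r_end r_rec r_sum r_norm) hB => //.
by rewrite q0.
Qed.

Lemma sum_integral_evolution_le (m : nat) :
  (\sum_(q <= n < m) \int[mu]_(t in `[0%R, +oo[)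
    (Normc.normc (evolution V t n.+1) ^+ 2 * expR (- eta * t))%:E <=
   (2 * (1 + 2 / eta ^+ 2) / B / eta)%:E)%E.
Proof.
(* The truncation has [k + (q + m)] sites, so that it contains [q] and the first [m] sites for every
   [k]. *)
have H k : exists cs : (nat -> R -> R) * (nat -> R -> R),
  [/\ forall n, continuous (fun t => (cs.1 n t ^+ 2 + cs.2 n t ^+ 2) * expR (- eta * t)),
      forall n t, (n <= k + (q + m))%N ->
        `|cos_series ((moment V)^~ n) t - cs.1 n t| <=
          2 * exp_tail (`|t| * K) (k + (q + m) - n).+1 /\
        `|sin_series ((moment V)^~ n) t - cs.2 n t| <=
          2 * exp_tail (`|t| * K) (k + (q + m) - n).+1 &
      forall m', (m' <= k + (q + m))%N ->
        (\sum_(q <= n < m') \int[mu]_(t in `[0%R, +oo[)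
          ((cs.1 n.+1 t ^+ 2 + cs.2 n.+1 t ^+ 2) * expR (- eta * t))%:E <=
        (2 * (1 + 2 / eta ^+ 2) / B / eta)%:E)%E].
  have [c [s h]] := @truncated_evolution (k + (q + m)) (ltac:(lia)).
  by exists (c, s).
have [cs hcs] := choice H.
pose g k n t : R := ((cs k).1 n t ^+ 2 + (cs k).2 n t ^+ 2) * expR (- eta * t).
pose f n t : R := Normc.normc (evolution V t n) ^+ 2 * expR (- eta * t).
have gc k n : continuous (g k n) by have [h _ _] := hcs k; exact: h.
have g0 k n t : 0 <= g k n t by rewrite mulr_ge0 ?expR_ge0 // addr_ge0 ?sqr_ge0.
have f0 n t : 0 <= f n t by rewrite mulr_ge0 ?expR_ge0 // sqr_ge0.
have tail0 n (t : R) : 2 * exp_tail (`|t| * K) (k + (q + m) - n).+1 @[k --> \oo] --> 0.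
  rewrite -(mulr0 2); apply: cvgMr.
  apply/cvgrPdist_le => e e0; have /cvgrPdist_le/(_ e e0)[M _ hM] := @cvg_exp_tail R (`|t| * K).
  exists (n + M)%N => // k /= hk; apply: hM => /=; lia.
have close_cvg (u : nat -> R) (l : R) n (t : R) :
    (forall k, (n <= k + (q + m))%N ->
      `|l - u k| <= 2 * exp_tail (`|t| * K) (k + (q + m) - n).+1) ->
    u @ \oo --> l.
  move=> hu; apply/cvgrPdist_le => e e0.
  have /cvgrPdist_le/(_ e e0)[M _ hM] := tail0 n t.
  exists (n + M)%N => // k /= hk; apply: le_trans (hu k _) _; first lia.
  have := hM k (ltac:(rewrite /=; lia)); rewrite sub0r normrN.
  exact: le_trans (ler_norm _).
have gf n t : g k n t @[k --> \oo] --> f n t.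
  apply: cvgM; last exact: cvg_cst.
  rewrite sqnormc_normc (evolutionE K2 hK) /sqnormc /= sqrrN.
  apply: cvgD; rewrite !expr2; apply: cvgM;
    by apply: (close_cvg _ _ n t) => k nk; have [_ /(_ n t nk)[]] := hcs k.
have mg k n : measurable_fun (`[0%R, +oo[%classic : set R) (g k n).
  by apply: measurable_funTS; exact: continuous_measurable_fun.
have mf n : measurable_fun (`[0%R, +oo[%classic : set R) (f n).
  by apply: (@measurable_fun_cvg _ _ _ _ (g^~ n)) => // t _; exact: gf.
rewrite -ge0_integral_sum //; last 2 first.
  by move=> n; apply/measurable_EFinP; exact: mf.
  by move=> n t _; rewrite lee_fin; exact: f0.
pose G k t := (\sum_(q <= n < m) (g k n.+1 t)%:E)%E.
(* The integrand is the pointwise limit of the truncated ones, hence their lower limit, which is the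
   form needed for Fatou. *)
have fG : {in `[0, +oo[%classic, (fun t => \sum_(q <= n < m) (f n.+1 t)%:E)%E =1
    (fun t => limn_einf (G^~ t))}.
  move=> t _; rewrite /G.
  have cG : (\sum_(q <= n < m) (g k n.+1 t)%:E)%E @[k --> \oo] -->
      (\sum_(q <= n < m) (f n.+1 t)%:E)%E.
    rewrite sumEFin; under eq_cvg do rewrite sumEFin.
    apply: cvg_EFin; first exact: nearW.
    by apply: (cvg_big (op := +%R)) => [|n _]; [exact: add_continuous|exact: gf].
  by have [-> _] := cvg_limn_einf_sup cG.
apply: le_trans (_ : (\int[mu]_(t in `[0%R, +oo[) limn_einf (G^~ t) <= _)%E).
  by rewrite le_eqVlt; apply/orP; left; apply/eqP; apply: eq_integral; exact: fG.
apply: le_trans (fatou _ _ _ _) _ => //.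
- move=> k; apply: emeasurable_sum => n; apply/measurable_EFinP; exact: mg.
- by move=> k t _; rewrite /G sume_ge0 // => n _; rewrite lee_fin.
rewrite limn_einf_lim; apply: lime_le; first exact: is_cvg_einfs.
apply: nearW => k; apply: le_trans (_ : (\int[mu]_(t in `[0%R, +oo[) G k t <= _)%E).
  by apply: ereal_inf_lbound; exists k => /=.
rewrite /G ge0_integral_sum //; last 2 first.
  by move=> n; apply/measurable_EFinP; exact: mg.
  by move=> n t _; rewrite lee_fin.
by have [_ _ h] := hcs k; apply: h; lia.
Qed.

End OutsideProbability.

Lemma outside_prob_le (R : realType) (V : nat -> R) (q : nat) (x T B : R) :
  bounded_potential V -> (0 < q)%N -> q%:R <= x -> 0 < T -> 0 < B ->
  (forall z : R[i], cIm z = 2 / T -> B <= Normc.normc (discr V q z)) ->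
  (outside_prob V x T <= (2 * (1 + 2 / (2 / T) ^+ 2) / B)%:E)%E.
Proof.
move=> [M hM] q0 qx T0 B0 hB; have eta0 : 0 < 2 / T by rewrite divr_gt0.
have M0 : 0 <= M by exact: le_trans (normr_ge0 _) (hM 1%N isT).
have K2 : 2 <= M + 2 by rewrite lerDr.
have hK n : (1 <= n)%N -> `|V n| <= (M + 2) - 2 by rewrite addrK; exact: hM.
pose I n : \bar R := (\int[lebesgue_measure]_(t in `[0%R, +oo[%classic)
       (Normc.normc (evolution V t n) ^+ 2 * expR (- (2 * t / T)))%:E)%E.
have I0 n : (0 <= I n)%E.
  by apply: integral_ge0 => t _; rewrite lee_fin mulr_ge0 ?expR_ge0 // sqr_ge0.
have u0 n : (0 <= (2 / T)%:E * I n)%E by rewrite mule_ge0 // lee_fin ltW.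
rewrite /outside_prob; apply: lime_le; first by apply: is_cvg_nneseries_cond => n _ _; exact: u0.
apply: nearW => m; rewrite -/I.
(* Since [q <= x], relaxing [x < n] to [q < n] only adds terms. The upper end is raised so that
   [q.+1] lies in the range. *)
apply: le_trans (_ : \sum_(0 <= n < m.+1 + q | (q < n)%N) (2 / T)%:E * I n <= _)%E.
  rewrite [in leRHS](big_cat_nat (n := m)) //=; last by lia.
  apply: le_trans (leeDl _ _); last by apply: sume_ge0 => n _; exact: u0.
  rewrite big_mkcond [leRHS]big_mkcond /=; apply: lee_sum => n _.
  case: ifPn => [xn|_]; last by case: ifP.
  by rewrite (_ : (q < n)%N) // -(ltr_nat R) (le_lt_trans qx).
rewrite (big_cat_nat (n := q.+1)) //=; last by lia.
rewrite big_nat_cond big1 ?add0e; last by move=> n /andP[/andP[_ ?] ?]; lia.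
rewrite big_add1 /= big_nat_cond.
rewrite (eq_bigl (fun n => (q <= n < m + q)%N)); last first.
  by move=> n /=; lia.
rewrite -big_nat -ge0_sume_distrr; last by move=> n _; exact: I0.
have := sum_integral_evolution_le K2 hK q0 eta0 B0 hB (m + q).
rewrite (eq_bigr (fun n => I n.+1)); last first.
  move=> n _; apply: eq_integral => t _; congr ((_ * expR _)%:E); ring.
move=> h; apply: le_trans (lee_wpmul2l _ h) _; first by rewrite lee_fin ltW.
rewrite -EFinM lee_fin le_eqVlt; apply/orP; left; apply/eqP; field.
by rewrite !gt_eqF.
Qed.

(** * Exponents *)

Section Exponents.
Variable R : realType.

Lemma lne_le_ln (x : \bar R) (r : R) : 0 < r -> (x <= r%:E)%E -> (lne x <= (ln r)%:E)%E.
Proof.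
move=> r0; case: x => [s||] /=; [|by rewrite leye_eq|by move=> _; rewrite leNye].
rewrite lee_fin => sr; case: ifPn => [_|]; first by rewrite leNye.
by rewrite -ltNge lee_fin => s0; rewrite ler_ln.
Qed.

Lemma le_all_ltNy (x : \bar R) : (forall M : R, 0 <= M -> (x <= (- M)%:E)%E) -> ~ (-oo < x)%E.
Proof.
case: x => [s||] h // _; last by have := h 0 (lexx _); rewrite leye_eq.
have h1 := h (`|s| + 1) (addr_ge0 (normr_ge0 s) ler01); rewrite lee_fin in h1.
have := ler_norm (- s); rewrite normrN; lra.
Qed.

Lemma expR_ge_sqr (y : R) : 0 <= y -> y ^+ 2 / 4 <= expR y.
Proof.
move=> y0; have -> : y = y / 2 + y / 2 by field.
rewrite expRD; have := expR_ge1Dx (y / 2); nra.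
Qed.

(* In logarithmic scale: [tau = ln T], [kap = ln q] and [c = ln C]. *)
Lemma log_threshold (alpha a xi c M : R) :
  0 < alpha -> alpha < a -> 0 < xi -> 0 <= c -> 0 <= M ->
  exists2 tau0, 1 <= tau0 & forall tau kap : R, tau0 <= tau -> a * tau <= c + kap ->
    tau + 3 <= kap / alpha /\ (3 + M) * tau <= expR (xi * kap).
Proof.
move=> al0 ala xi0 c0 M0; have a0 : 0 < a by exact: lt_trans ala.
(* In turn, [t1] secures [tau + 3 <= kap / alpha], using [alpha < a]; [t2] secures
   [kap >= a * tau / 2]; and [t3] makes the quadratic lower bound on the exponential exceed
   [(3 + M) * tau]. *)
pose t1 := (3 * alpha + c) / (a - alpha); pose t2 := 2 * c / a.
pose t3 := 16 * (3 + M) / (xi * a) ^+ 2.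
have d0 : 0 < a - alpha by rewrite subr_gt0.
have xa0 : 0 < xi * a by exact: mulr_gt0.
have t10 : 0 <= t1 by rewrite divr_ge0 ?(ltW d0) // addr_ge0 ?mulr_ge0 ?(ltW al0).
have t20 : 0 <= t2 by rewrite divr_ge0 ?(ltW a0) // mulr_ge0.
have t30 : 0 <= t3 by rewrite divr_ge0 ?sqr_ge0 // mulr_ge0 // addr_ge0.
exists (1 + t1 + t2 + t3); first lra.
move=> tau kap htau hk.
have h1 : 3 * alpha + c <= tau * (a - alpha).
  by rewrite -ler_pdivrMr // -/t1; lra.
have h2 : 2 * c <= tau * a by rewrite -ler_pdivrMr // -/t2; lra.
have h3 : 16 * (3 + M) <= tau * (xi * a) ^+ 2.
  by rewrite -ler_pdivrMr ?exprn_gt0 // -/t3; lra.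
have tau0 : 0 <= tau by lra.
split; first by rewrite ler_pdivlMr //; lra.
have k1 : xi * (a * tau / 2) <= xi * kap by rewrite ler_pM2l //; lra.
have y0 : 0 <= xi * (a * tau / 2).
  by rewrite mulr_ge0 ?(ltW xi0) // divr_ge0 // mulr_ge0 ?(ltW a0).
apply: le_trans (_ : expR (xi * (a * tau / 2)) <= _); last by rewrite ler_expR.
apply: le_trans (expR_ge_sqr y0).
have -> : (xi * (a * tau / 2)) ^+ 2 / 4 = tau * (tau * (xi * a) ^+ 2) / 16 by field.
rewrite ler_pdivlMr //.
have := ler_wpM2l tau0 h3; lra.
Qed.

Variables (V : nat -> R) (xi alpha : R) (q : nat -> nat).
Hypothesis V_bounded : bounded_potential V.
Hypotheses (xi0 : 0 < xi) (alpha0 : 0 < alpha).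
Hypothesis q_gt1 : forall l, (1 < q l)%N.
Hypothesis q_clustered : forall l, clustered (q l) (floquet_spectrum V (q l))
  ((q l)%:R `^ (- (1 / alpha))) xi.

(** Up to constants [T] is the power [1 / a] of [q l]. As [a > alpha], for large [T] the height
    [2 / T] exceeds e^3 times the cluster length and [clustered_discr_ge] applies. The bound
    [(2 + T^2) exp (- q^xi)] is then below [T^(- M)]. *)
Lemma log_ratio_le (a C M : R) : alpha < a -> 1 <= C -> 0 <= M ->
  exists2 T0, 1 < T0 & forall T l, T0 <= T -> (q l)%:R <= T `^ a -> T `^ a <= C * (q l)%:R ->
    (log_ratio V a T <= (- M)%:E)%E.
Proof.
move=> ala C1 M0; have C0 : 0 < C by exact: lt_le_trans C1.
have c0 : 0 <= ln C by rewrite ln_ge0.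
have [tau0 tau1 H] := log_threshold alpha0 ala xi0 c0 M0.
exists (expR tau0); first by rewrite -expR0 ltr_expR; lra.
move=> T l TT qT Tq; have T0 : 0 < T by exact: lt_le_trans (expR_gt0 _) TT.
have qpos : 0 < (q l)%:R :> R by rewrite ltr0n (ltn_trans _ (q_gt1 l)).
have htau : tau0 <= ln T by rewrite -(expRK tau0) ler_ln ?posrE ?expR_gt0.
have hk : a * ln T <= ln C + ln (q l)%:R.
  by rewrite -lnM ?posrE // -ln_powR ler_ln ?posrE ?powR_gt0 // mulr_gt0.
have [h1 h2] := H _ _ htau hk.
set eps := (q l)%:R `^ (- (1 / alpha)) : R; have eps0 : 0 < eps by exact: powR_gt0.
have eta0 : 0 < 2 / T by rewrite divr_gt0.
have ln2 : 0 <= ln 2 :> R by rewrite ln_ge0 // ler1n.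
have lneps : ln eps + 3 <= ln (2 / T).
  rewrite ln_powR ln_div ?posrE //.
  have -> : - (1 / alpha) * ln (q l)%:R = - (ln (q l)%:R / alpha) by ring.
  lra.
have epseta : eps <= 2 / T by rewrite -ler_ln ?posrE //; lra.
have := @outside_prob_le R V (q l) (T `^ a) T (expR ((q l)%:R `^ xi)) V_bounded
  (ltnW (q_gt1 l)) qT T0 (expR_gt0 _).
move=> /(_ (fun z hz => clustered_discr_ge (q_gt1 l) xi0 eps0 epseta lneps (q_clustered l) hz)).
set Bd := _ / _; move=> hP.
have num0 : 0 < 2 * (1 + 2 / (2 / T) ^+ 2) :> R.
  by rewrite mulr_gt0 // ltr_pwDl // divr_ge0 // sqr_ge0.
have Bd0 : 0 < Bd by rewrite divr_gt0 // expR_gt0.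
have lnT0 : 0 < ln T by lra.
apply: le_trans (lee_wpmul2r _ (lne_le_ln Bd0 hP)) _; first by rewrite lee_fin invr_ge0 ltW.
rewrite -EFinM lee_fin ler_pdivrMr // /Bd ln_div ?posrE ?expR_gt0 // expRK.
have -> : (q l)%:R `^ xi = expR (xi * ln (q l)%:R) by rewrite /powR gt_eqF.
(* From [tau0 >= 1]. It gives [2 + T^2 <= T^3], the origin of the 3 in [(3 + M) * tau]. *)
have T2 : 2 <= T.
  have := expR_ge1Dx tau0; lra.
have hnum : ln (2 * (1 + 2 / (2 / T) ^+ 2)) <= 3 * ln T.
  rewrite [X in _ <= X]mulr_natl -lnXn // ler_ln ?posrE ?exprn_gt0 //.
  have -> : 2 * (1 + 2 / (2 / T) ^+ 2) = 2 + T ^+ 2 by field; rewrite gt_eqF.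
  by rewrite !exprS expr0; nra.
lra.
Qed.

Hypothesis q_incr : forall l m, (l < m)%N -> (q l < q m)%N.

Lemma q_ge l : (l <= q l)%N.
Proof. by elim: l => // l IH; apply: leq_ltn_trans IH (q_incr (ltnSn l)). Qed.

Lemma limf_einf_log_ratio (a : R) : alpha < a ->
  ~ (-oo < limf_einf (log_ratio V a) (pinfty_nbhs R))%E.
Proof.
move=> ala; have a0 : 0 < a by exact: lt_trans ala.
apply: le_all_ltNy => M M0; have [T0 T1 H] := log_ratio_le ala (lexx 1) M0.
rewrite limf_einfE; apply: ge_ereal_sup => _ [A [X [_ hX]] <-].
pose Y := Num.max T0 (X + 1).
have Y0 : 0 < Y by rewrite lt_max (lt_trans ltr01 T1).
(* With this [T], [T ^ a] equals [q l], so [C = 1] works. Such [T] exist beyond any bound because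
   [l <= q l], and that is all a lower limit asks for. *)
pose l := (Num.truncn (Y `^ a)).+1; pose T : R := (q l)%:R `^ a^-1.
have qpos : 0 < (q l)%:R :> R by rewrite ltr0n (ltn_trans _ (q_gt1 l)).
have Ta : T `^ a = (q l)%:R by rewrite /T -powRrM mulVf ?gt_eqF // powRr1 // ltW.
have YT : Y <= T.
  rewrite leNgt; apply/negP => TY.
  have T0' : T \in Num.nneg by rewrite nnegrE powR_ge0.
  have Y0' : Y \in Num.nneg by rewrite nnegrE ltW.
  have := gt0_ltr_powR a0 T0' Y0' TY; rewrite Ta => h.
  have : Y `^ a < (q l)%:R.
    by rewrite (lt_le_trans (truncnS_gt _)) // ler_nat; exact: q_ge.
  by move/(lt_trans h); rewrite ltxx.
apply: le_trans (_ : (log_ratio V a T <= _)%E); last first.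
  apply: (H T l); rewrite ?Ta ?mul1r //.
  by apply: le_trans YT; rewrite le_max lexx.
apply: ereal_inf_lbound; exists T => //; apply: hX.
by apply: lt_le_trans YT; rewrite lt_max ltrDl ltr01 orbT.
Qed.

(** An upper limit needs every large [T]. Bounded ratios of consecutive terms place some [q l] below
    [T ^ a] and within a factor [C] of it. *)
Lemma limf_esup_log_ratio (a : R) : alpha < a ->
  exponentially_growing (fun l => (q l)%:R : R) ->
  ~ (-oo < limf_esup (log_ratio V a) (pinfty_nbhs R))%E.
Proof.
move=> ala [supq _]; have a0 : 0 < a by exact: lt_trans ala.
have qpos l : 0 < (q l)%:R :> R by rewrite ltr0n (ltn_trans _ (q_gt1 l)).
have [C C1 hC] : exists2 C : R, 1 <= C & forall l, (q l.+1)%:R <= C * (q l)%:R.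
  move: supq; set S := ereal_sup _ => hS.
  have hq l : (((q l.+1)%:R / (q l)%:R : R)%:E <= S)%E.
    by apply: ereal_sup_ubound; exists l.
  case: S hS hq => [s||] // _ hq; last by have := hq 0%N; rewrite leeNy_eq.
  exists (Num.max 1 s); first by rewrite le_max lexx.
  move=> l; rewrite -ler_pdivrMr // le_max; apply/orP; right.
  by rewrite -lee_fin; exact: hq.
apply: le_all_ltNy => M M0; have [T0 T1 H] := log_ratio_le ala C1 M0.
rewrite limf_esupE.
pose X : R := Num.max T0 ((q 0)%:R `^ a^-1).
apply: (@le_trans _ _ (ereal_sup (log_ratio V a @` [set T | X < T]))).
  apply: ereal_inf_lbound; exists [set T | X < T] => //.
  by exists X; split => //; exact: num_real.
apply: ge_ereal_sup => _ [T /= XT <-].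
have T0T : T0 < T by apply: le_lt_trans XT; rewrite le_max lexx.
have Tpos : 0 < T by exact: lt_trans (lt_trans ltr01 T1) T0T.
have q0T : (q 0)%:R <= T `^ a.
  have qT : (q 0)%:R `^ a^-1 <= T.
    by apply: le_trans (ltW XT); rewrite le_max lexx orbT.
  have -> : (q 0)%:R = ((q 0)%:R `^ a^-1) `^ a :> R.
    by rewrite -powRrM mulVf ?gt_eqF // powRr1 // ltW.
  by apply: ge0_ler_powR; rewrite ?nnegrE ?powR_ge0 // ltW.
have ex : exists l, (T `^ a < (q l)%:R).
  exists (Num.truncn (T `^ a)).+1.
  by rewrite (lt_le_trans (truncnS_gt _)) // ler_nat; exact: q_ge.
(* The first term above [T ^ a] is not [q 0]; its predecessor [q l] satisfies
   [q l <= T ^ a < q l.+1 <= C * q l]. *)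
case: (ex_minnP ex) => -[|l] hl minl.
  by move: hl; rewrite ltNge q0T.
apply: (H T l); first exact: ltW.
  by rewrite leNgt; apply/negP => /minl; rewrite ltnn.
by apply: le_trans (ltW hl) _; exact: hC.
Qed.

End Exponents.

Theorem corollary1p6 (R : realType) (V : nat -> R) (xi alpha : R)
    (q : nat -> nat)
    (V_bounded : bounded_potential V)
    (xi_gt : 2 / 3 < xi) (xi_le : xi <= 1)
    (alpha_gt0 : 0 < alpha) (alpha_lt1 : alpha < 1)
    (q_gt1 : forall l : nat, (1 < q l)%N)
    (q_incr : forall l m : nat, (l < m)%N -> (q l < q m)%N)
    (q_clustered : forall l : nat,
      clustered (q l) (floquet_spectrum V (q l))
        ((q l)%:R `^ (- (1 / alpha))) xi) :
  (alpha_u_minus V <= alpha%:E)%E /\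
  (exponentially_growing (fun l : nat => (q l)%:R : R) ->
    (alpha_u_plus V <= alpha%:E)%E).
Proof.
have xi0 : 0 < xi by apply: lt_trans xi_gt; rewrite divr_gt0.
split=> [|growing]; rewrite ge_max lee_fin ltW //=;
  apply: ge_ereal_sup => _ [a /= [_ ha] <-]; rewrite lee_fin leNgt; apply/negP => ala.
- exact: (limf_einf_log_ratio V_bounded xi0 alpha_gt0 q_gt1 q_clustered q_incr ala).
- exact: (limf_esup_log_ratio V_bounded xi0 alpha_gt0 q_gt1 q_clustered q_incr ala growing).
Qed.
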